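(* The satisfiability problem of $\mathtt{PH}$ (Presburger arithmetic with Härtig quantifier) is reducible in exponential time both to $\mathrm{MC}(\mathtt{FKS},\mathtt{CLTL})$ and to $\mathrm{MC}(\mathtt{FKS},\mathtt{CCTL})$; that is, there are exponential-time computable maps sending each $\mathtt{PH}$ formula $\Phi$ to an instance $(\mathcal{K},\hat\Phi)$ of the respective model-checking problem such that $\Phi$ is satisfiable if and only if $\mathcal{K}\models\hat\Phi$.
   Context: $\mathtt{PH}$: formulae over a set of variables $V$ given by $\varphi ::= \tau\le\tau\mid\neg\varphi\mid\varphi\land\varphi\mid\exists x.\varphi\mid\exists^{=x}y.\varphi$, terms $\tau ::= a\mid a\cdot x\mid\tau+\tau$ with $a\in\mathbb{N}$, $x,y\in V$. Semantics over valuations $\eta:V\to\mathbb{N}$ as usual for first-order logic over $(\mathbb{N},+)$, and $\eta\models\exists^{=x}y.\varphi$ iff the set $\{b\in\mathbb{N}\mid\eta[y\mapsto b]\models\varphi\}$ is finite and has cardinality $\eta(x)$. Satisfiability: does some $\eta$ satisfy $\varphi$? Kripke structure $\mathcal{K}=(S,s_I,E,\lambda)$: finite $S$, $s_I\in S$, $E\subseteq S\times S$, $\lambda:S\to2^{AP}$ ($AP$ finite). Runs: infinite paths $\rho$ with $\rho(0)=s_I$; $\mathtt{Runs}(\mathcal{K})$. Simple loop: finite path of pairwise distinct states $s_0\dots s_k$ with $(s_k,s_0)\in E$; $\mathcal{K}$ is flat if each state is the first state of at most one simple loop; $\mathtt{FKS}$ is the class of flat Kripke structures. $\mathtt{CCTL^*}$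 over variables $V$: $\varphi ::= p\mid\varphi\land\varphi\mid\neg\varphi\mid\mathtt{X}\varphi\mid\varphi\mathtt{U}\varphi\mid\mathtt{E}\varphi\mid x.\varphi\mid\tau\le\tau$, $\tau ::= a\mid a\cdot\#_x(\varphi)\mid\tau+\tau$ ($p\in AP$, $x\in V$, $a\in\mathbb{Z}$). Semantics over a run $\rho$, position $i$, valuation $\theta:V\to\mathbb{N}$: $p$ iff $p\in\lambda(\rho(i))$; Booleans usual; $\mathtt{X}\varphi$ iff $(\rho,i+1,\theta)\models\varphi$; $\varphi\mathtt{U}\psi$ iff some $k\ge i$ has $(\rho,k,\theta)\models\psi$ and $(\rho,j,\theta)\models\varphi$ for all $j\in[i,k-1]$; $\mathtt{E}\varphi$ iff some $\rho'\in\mathtt{Runs}(\mathcal{K})$ agrees with $\rho$ on positions $0..i$ and $(\rho',i,\theta)\models\varphi$; $x.\varphi$ iff $(\rho,i,\theta[x\mapsto i])\models\varphi$; $\tau_1\le\tau_2$ iff $[\![\tau_1]\!]\le[\![\tau_2]\!]$, where $[\![a]\!]=a$, $[\![\tau_1+\tau_2]\!]$ is the sum, $[\![a\cdot\#_x(\varphi)]\!]=a\cdot|\{j\mid\theta(x)\le j\le i,(\rho,j,\theta)\models\varphi\}|$. Abbreviations: $\mathtt{A}\varphi=\neg\mathtt{E}\neg\varphi$, $\mathtt{F}\varphi=\top\mathtt{U}\varphi$, $\mathtt{G}\varphi=\neg\mathtt{F}\neg\varphi$. A state $s$ satisfies $\varphi$ if some $\rho\in\mathtt{Runs}(\mathcal{K})$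 and $i$ have $\rho(i)=s$ and $(\rho,i,\mathbf{0})\models\varphi$; $\mathcal{K}\models\varphi$ iff $s_I$ satisfies $\varphi$. $\mathtt{CLTL}$: $\mathtt{CCTL^*}$ formulae without $\mathtt{E},\mathtt{A}$. $\mathtt{CCTL}$: $\mathtt{CCTL^*}$ formulae in which every occurrence of $\mathtt{X}$ and $\mathtt{U}$ is immediately preceded by $\mathtt{E}$ or $\mathtt{A}$. $\mathrm{MC}(\mathfrak{K},\mathcal{L})$: given $\mathcal{K}\in\mathfrak{K}$, $\varphi\in\mathcal{L}$, decide $\mathcal{K}\models\varphi$. *)

(* Defs.v *)
From mathcomp Require Import all_boot all_order all_algebra.
From Stdlib Require Import ClassicalEpsilon.
Set Implicit Arguments. Unset Strict Implicit. Unset Printing Implicit Defensive.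
Import Order.TTheory GRing.Theory Num.Theory.

Definition upd (eta : nat -> nat) (x b : nat) : nat -> nat :=
  fun z => if z == x then b else eta z.

Inductive ph_term : Type :=
| PT_const of nat
| PT_mul of nat & nat
| PT_add of ph_term & ph_term.

Inductive ph_form : Type :=
| PH_le of ph_term & ph_term
| PH_not of ph_form
| PH_and of ph_form & ph_form
| PH_ex of nat & ph_form
| PH_hartig of nat & nat & ph_form.

Fixpoint ph_eval (eta : nat -> nat) (t : ph_term) : nat :=
  match t with
  | PT_const a => a
  | PT_mul a x => a * eta x
  | PT_add t1 t2 => ph_eval eta t1 + ph_eval eta t2
  end.

Fixpoint ph_holds (eta : nat -> nat) (f : ph_form) : Prop :=
  match f with
  | PH_le t1 t2 => ph_eval eta t1 <= ph_eval eta t2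
  | PH_not g => ~ ph_holds eta g
  | PH_and g h => ph_holds eta g /\ ph_holds eta h
  | PH_ex x g => exists b, ph_holds (upd eta x b) g
  | PH_hartig x y g =>
      exists s : seq nat, uniq s /\
        (forall b, b \in s <-> ph_holds (upd eta y b) g) /\ size s = eta x
  end.

Definition ph_satisfiable (f : ph_form) : Prop := exists eta, ph_holds eta f.

Record KS : Type := {
  ks_size : nat;
  ks_init : 'I_ks_size;
  ks_edge : 'I_ks_size -> 'I_ks_size -> bool;
  ks_label : 'I_ks_size -> seq nat }.

Definition is_run (K : KS) (rho : nat -> 'I_(ks_size K)) : Prop :=
  rho 0 = ks_init K /\ forall i, ks_edge (rho i) (rho i.+1).

Definition simple_loop (K : KS) (s : 'I_(ks_size K)) (r : seq 'I_(ks_size K)) : bool :=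
  [&& uniq (s :: r), path (@ks_edge K) s r & ks_edge (last s r) s].

Definition flat (K : KS) : Prop :=
  forall (s : 'I_(ks_size K)) r1 r2, simple_loop s r1 -> simple_loop s r2 -> r1 = r2.

Inductive cform : Type :=
| C_ap of nat
| C_and of cform & cform
| C_not of cform
| C_X of cform
| C_U of cform & cform
| C_E of cform
| C_bind of nat & cform
| C_le of cterm & cterm
with cterm : Type :=
| CT_const of int
| CT_count of int & nat & cform
| CT_add of cterm & cterm.

Definition pdec (P : Prop) : nat :=
  if excluded_middle_informative P then 1 else 0.

Fixpoint csem (K : KS) (rho : nat -> 'I_(ks_size K)) (i : nat)
    (th : nat -> nat) (f : cform) {struct f} : Prop :=
  match f with
  | C_ap p => p \in ks_label (rho i)
  | C_and g h => csem rho i th g /\ csem rho i th h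
  | C_not g => ~ csem rho i th g
  | C_X g => csem rho i.+1 th g
  | C_U g h => exists k, i <= k /\ csem rho k th h /\
                 forall j, i <= j < k -> csem rho j th g
  | C_E g => exists rho', is_run rho' /\ (forall j, j <= i -> rho' j = rho j) /\
                 csem rho' i th g
  | C_bind x g => csem rho i (upd th x i) g
  | C_le t1 t2 => (ceval rho i th t1 <= ceval rho i th t2)%R
  end
with ceval (K : KS) (rho : nat -> 'I_(ks_size K)) (i : nat)
    (th : nat -> nat) (t : cterm) {struct t} : int :=
  match t with
  | CT_const a => a
  | CT_count a x g =>
      (a * (\sum_(th x <= j < i.+1) pdec (csem rho j th g))%:Z)%R
  | CT_add t1 t2 => (ceval rho i th t1 + ceval rho i th t2)%R
  end.

Definition models (K : KS) (f : cform) : Prop :=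
  exists rho i, is_run rho /\ rho i = ks_init K /\ csem rho i (fun _ => 0) f.

Fixpoint is_cltl (f : cform) : bool :=
  match f with
  | C_ap _ => true
  | C_and g h => is_cltl g && is_cltl h
  | C_not g => is_cltl g
  | C_X g => is_cltl g
  | C_U g h => is_cltl g && is_cltl h
  | C_E _ => false
  | C_bind _ g => is_cltl g
  | C_le t1 t2 => is_cltl_t t1 && is_cltl_t t2
  end
with is_cltl_t (t : cterm) : bool :=
  match t with
  | CT_const _ => true
  | CT_count _ _ g => is_cltl g
  | CT_add t1 t2 => is_cltl_t t1 && is_cltl_t t2
  end.

(** CCTL: every X / U is immediately preceded by E or by A = not E not.
    Thus X and U may only occur as E X g, E U g h, E not X g, E not U g h. *)
Fixpoint is_cctl (f : cform) : bool :=
  match f with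
  | C_ap _ => true
  | C_and g h => is_cctl g && is_cctl h
  | C_not g => is_cctl g
  | C_X _ => false
  | C_U _ _ => false
  | C_E (C_X g) => is_cctl g
  | C_E (C_U g h) => is_cctl g && is_cctl h
  | C_E (C_not (C_X g)) => is_cctl g
  | C_E (C_not (C_U g h)) => is_cctl g && is_cctl h
  | C_E g => is_cctl g
  | C_bind _ g => is_cctl g
  | C_le t1 t2 => is_cctl_t t1 && is_cctl_t t2
  end
with is_cctl_t (t : cterm) : bool :=
  match t with
  | CT_const _ => true
  | CT_count _ _ g => is_cctl g
  | CT_add t1 t2 => is_cctl_t t1 && is_cctl_t t2
  end.

(** * Binary encodings (prefix-free, numbers in binary) *)
Fixpoint bin_aux (k n : nat) : seq bool :=
  match k with
  | 0 => [::]
  | k'.+1 => if n == 0 then [::] else odd n :: bin_aux k' n./2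
  end.

(** each binary digit b (least significant first) is written as [true; b],
    and the number is terminated by false *)
Definition enc_nat (n : nat) : seq bool :=
  flatten [seq [:: true; b] | b <- bin_aux n n] ++ [:: false].

Definition enc_int (a : int) : seq bool :=
  match a with
  | Posz n => false :: enc_nat n
  | Negz n => true :: enc_nat n
  end.

Fixpoint enc_ph_term (t : ph_term) : seq bool :=
  match t with
  | PT_const a => enc_nat 0 ++ enc_nat a
  | PT_mul a x => enc_nat 1 ++ enc_nat a ++ enc_nat x
  | PT_add t1 t2 => enc_nat 2 ++ enc_ph_term t1 ++ enc_ph_term t2
  end.

Fixpoint enc_ph (f : ph_form) : seq bool :=
  match f with
  | PH_le t1 t2 => enc_nat 0 ++ enc_ph_term t1 ++ enc_ph_term t2
  | PH_not g => enc_nat 1 ++ enc_ph g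
  | PH_and g h => enc_nat 2 ++ enc_ph g ++ enc_ph h
  | PH_ex x g => enc_nat 3 ++ enc_nat x ++ enc_ph g
  | PH_hartig x y g => enc_nat 4 ++ enc_nat x ++ enc_nat y ++ enc_ph g
  end.

Fixpoint enc_cform (f : cform) : seq bool :=
  match f with
  | C_ap p => enc_nat 0 ++ enc_nat p
  | C_and g h => enc_nat 1 ++ enc_cform g ++ enc_cform h
  | C_not g => enc_nat 2 ++ enc_cform g
  | C_X g => enc_nat 3 ++ enc_cform g
  | C_U g h => enc_nat 4 ++ enc_cform g ++ enc_cform h
  | C_E g => enc_nat 5 ++ enc_cform g
  | C_bind x g => enc_nat 6 ++ enc_nat x ++ enc_cform g
  | C_le t1 t2 => enc_nat 7 ++ enc_cterm t1 ++ enc_cterm t2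
  end
with enc_cterm (t : cterm) : seq bool :=
  match t with
  | CT_const a => enc_nat 0 ++ enc_int a
  | CT_count a x g => enc_nat 1 ++ enc_int a ++ enc_nat x ++ enc_cform g
  | CT_add t1 t2 => enc_nat 2 ++ enc_cterm t1 ++ enc_cterm t2
  end.

Definition enc_list (l : seq nat) : seq bool :=
  enc_nat (size l) ++ flatten (map enc_nat l).

Definition enc_ks (K : KS) : seq bool :=
  enc_nat (ks_size K) ++ enc_nat (ks_init K)
  ++ [seq ks_edge s t | s <- enum 'I_(ks_size K), t <- enum 'I_(ks_size K)]
  ++ flatten [seq enc_list (ks_label s) | s <- enum 'I_(ks_size K)].

Definition enc_instance (K : KS) (f : cform) : seq bool := enc_ks K ++ enc_cform f.

(** * Deterministic single-tape Turing machines over {0,1,blank}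
    (blank = None), finitely many states 'I_tm_nstates. *)
Record TM : Type := {
  tm_nstates : nat;
  tm_start : 'I_tm_nstates;
  (* None = halt; Some (q', written symbol, move right?) *)
  tm_delta : 'I_tm_nstates -> option bool ->
             option ('I_tm_nstates * option bool * bool) }.

(** configuration: state, left part of tape (nearest cell first),
    scanned cell, right part of tape *)
Definition config (M : TM) : Type :=
  ('I_(tm_nstates M) * seq (option bool) * option bool * seq (option bool))%type.

Definition tm_step (M : TM) (c : config M) : option (config M) :=
  let '(q, L, h, R) := c in
  match tm_delta q h with
  | None => None
  | Some (q', w, true) => Some (q', w :: L, head None R, behead R)
  | Some (q', w, false) => Some (q', behead L, head None L, w :: R)
  end.

Fixpoint tm_run (M : TM) (k : nat) (c : config M) : config M :=
  match k with
  | 0 => c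
  | k'.+1 => match tm_step c with None => c | Some c' => tm_run k' c' end
  end.

Definition tm_halted (M : TM) (c : config M) : bool :=
  let '(q, _, h, _) := c in tm_delta q h == None.

Definition tm_init (M : TM) (w : seq bool) : config M :=
  (tm_start M, [::], head None (map Some w), map Some (behead w)).

Fixpoint read_bits (s : seq (option bool)) : seq bool :=
  match s with
  | Some b :: s' => b :: read_bits s'
  | _ => [::]
  end.

Definition tm_output (M : TM) (c : config M) : seq bool :=
  let '(_, _, h, R) := c in read_bits (h :: R).

Definition tm_computes_within (M : TM) (w v : seq bool) (T : nat) : Prop :=
  exists k, k <= T /\ tm_halted (tm_run k (tm_init M w)) /\
            tm_output (tm_run k (tm_init M w)) = v.

Definition exp_bound (c n : nat) : nat := 2 ^ (n.+2 ^ c).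

Definition exptime_reduction_to_MC_FKS (frag : cform -> bool) : Prop :=
  exists (M : TM) (c : nat), forall Phi : ph_form,
    exists (K : KS) (Phihat : cform),
      tm_computes_within M (enc_ph Phi) (enc_instance K Phihat)
        (exp_bound c (size (enc_ph Phi))) /\
      flat K /\ frag Phihat /\
      (ph_satisfiable Phi <-> models K Phihat).

(* Main.v *)
(* The Kripke structure is a single state with a self-loop: a position on its run
   is a natural number, "x." binds x to the current position, and
   F (1 <= #_z (x. phi)), with z bound to 0, says that some natural number x satisfies
   phi. Linear inequalities are evaluated far enough to the right, and the Hartig
   quantifier says that #_z (y. phi) is eventually equal to x.

   Equality of a count with x needs phi in both polarities, and duplicating phi would
   make the translation exponential. Instead, the translation of phi expresses
   "phi holds iff w <> 0" for a variable w, so that either polarity is obtained from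
   the same occurrence by rebinding w. The translation of a node is then a
   fixed string with holes for its numbers and its children, in the order of the input,
   and is computed by a machine which reads the input once, apart from re-reading
   numbers to copy them. *)

From HB Require Import structures.
Require Import Defs.
From mathcomp Require Import all_boot all_order all_algebra.
From Stdlib Require Import ClassicalEpsilon FunctionalExtensionality PropExtensionality.
From mathcomp Require Import zify.
Set Implicit Arguments. Unset Strict Implicit. Unset Printing Implicit Defensive.

(** * Formulas over a self-loop *)

(** Rebinding w settles negation and conjunction, but for the Hartig quantifier the prefix changes
    with the polarity as well: the count equals x from some B on if w <> 0, whereas for w = 0 every
    B has some N >= B where it differs. Hence the quantifiers themselves have to be controlled by w,
    see [c_switch]. The equality is split into two lower bounds: at least x of the numbers up to N
    satisfy phi, and at least N + 1 - x falsify it. A further bit, quantified along with N, selects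
    the bound and is also the value to which w is rebound inside the count, so that one count over
    one occurrence of phi serves for both bounds. Terms fit the same scheme by expressing that w is
    their value. One translation serves both fragments: on a structure with a single run, a path
    quantifier in front of [C_U] leaves the meaning unchanged. *)

Definition loop_ks : KS :=
  {| ks_size := 1; ks_init := ord0; ks_edge := fun _ _ => true;
     ks_label := fun _ => [::] |}.

Definition loop_run : nat -> 'I_(ks_size loop_ks) := fun _ => ord0.

Lemma loop_state (s t : 'I_(ks_size loop_ks)) : s = t.
Proof. by apply/val_inj; case: s t => [[|m] Hs] [[|n] Ht]. Qed.

Lemma loop_runE (rho : nat -> 'I_(ks_size loop_ks)) : rho = loop_run.
Proof. by apply: functional_extensionality => i; apply: loop_state. Qed.

Lemma loop_runP : is_run loop_run.
Proof. by split=> //; apply: loop_state. Qed.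

Lemma flat_loop_ks : flat loop_ks.
Proof.
have nilE (s : 'I_(ks_size loop_ks)) r : simple_loop s r -> r = [::].
  by case: r => // t r /and3P[/=]; rewrite (loop_state s t) inE eqxx.
by move=> s r1 r2 /nilE-> /nilE->.
Qed.

Notation sem := (csem loop_run).
Notation tsem := (ceval loop_run).

Definition c_top : cform := C_le (CT_const (Posz 0)) (CT_const (Posz 0)).

(** The flag [e] selects CCTL, where [C_U] must stand directly below a path quantifier; otherwise
    the result stays in CLTL. *)
Definition c_until (e : bool) (g h : cform) : cform :=
  if e then C_E (C_U g h) else C_U g h.

Definition c_F (e : bool) (g : cform) : cform := c_until e c_top g.

Definition c_FG (e : bool) (g : cform) : cform :=
  c_F e (C_not (c_F e (C_not g))).

(* A count reaches the positions before the current one as well, so [v]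
   ranges over all natural numbers and not just over the future. *)
Definition c_ex (e : bool) (v : nat) (g : cform) : cform :=
  c_F e (C_le (CT_const (Posz 1)) (CT_count (Posz 1) 0 (C_bind v g))).

Definition c_all (e : bool) (v : nat) (g : cform) : cform :=
  C_not (c_ex e v (C_not g)).

Lemma pdecE (P : Prop) (b : bool) : (P <-> b) -> pdec P = b.
Proof.
rewrite /pdec; case: excluded_middle_informative => [p [/(_ p)-> //]|np [_ h]].
by case: b h => // h; case: np; apply: h.
Qed.

Lemma pdec_true (P : Prop) : P -> pdec P = 1.
Proof. by move=> p; apply: (@pdecE P true). Qed.

Lemma pdec_not (P : Prop) : pdec (~ P) = 1 - pdec P.
Proof. by rewrite /pdec; do 2 case: excluded_middle_informative. Qed.

Lemma pdec_le1 (P : Prop) : pdec P <= 1.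
Proof. by rewrite /pdec; case: excluded_middle_informative. Qed.

Lemma pdec_gt0 (P : Prop) : (0 < pdec P) <-> P.
Proof. by rewrite /pdec; case: excluded_middle_informative. Qed.

Lemma eq_pdec (P Q : Prop) : (P <-> Q) -> pdec P = pdec Q.
Proof.
by move=> PQ; have -> : P = Q by apply: propositional_extensionality.
Qed.

Lemma sem_c_F e g i th : sem i th (c_F e g) <-> exists k, i <= k /\ sem k th g.
Proof.
have UP : sem i th (C_U c_top g) <-> exists k, i <= k /\ sem k th g.
  by split=> [[k [ik [gk _]]]|[k [ik gk]]]; exists k.
rewrite /c_F /c_until; case: e => //; rewrite -UP /=.
split=> [[rho [_ [_]]]|h]; first by rewrite (loop_runE rho).
by exists loop_run; split; first exact: loop_runP.
Qed.

(** Holding from some point on does not depend on the position of evaluation; this makes the guards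
    position-independent. *)
Lemma sem_c_FG e g i th :
  sem i th (c_FG e g) <-> exists B, forall j, B <= j -> sem j th g.
Proof.
have GP B : sem B th (C_not (c_F e (C_not g))) <-> forall j, B <= j -> sem j th g.
  split=> [nF j Bj|h].
    by apply: NNPP => ngj; apply: nF; apply/sem_c_F; exists j.
  by move=> /sem_c_F[j [Bj]]; apply; apply: h.
rewrite /c_FG sem_c_F; split=> [[k [_ /GP h]]|[B h]]; first by exists k.
exists (maxn i B); split; first exact: leq_maxl.
by apply/GP => j; rewrite geq_max => /andP[_]; apply: h.
Qed.

Lemma sum_pdec_gt0 (P : nat -> Prop) n :
  0 < \sum_(0 <= j < n) pdec (P j) <-> exists2 j, j < n & P j.
Proof.
rewrite lt0n; split=> [h|[j jn Pj]].
  apply: NNPP => nP; case/eqP: h; rewrite big_nat big1 // => j /andP[_ jn].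
  by rewrite (@pdecE _ false) //; split=> // Pj; case: nP; exists j.
by rewrite (big_rem j) /= ?mem_index_iota // pdec_true.
Qed.

Lemma tsem_count a x g i th :
  tsem i th (CT_count a x g) =
  (a * Posz (\sum_(th x <= j < i.+1) pdec (sem j th g)))%R.
Proof. by []. Qed.

Lemma sem_le t1 t2 i th :
  sem i th (C_le t1 t2) = (tsem i th t1 <= tsem i th t2)%R :> Prop.
Proof. by []. Qed.

Lemma sem_c_ex e v g i th : th 0 = 0 ->
  sem i th (c_ex e v g) <-> exists j, sem j (upd th v j) g.
Proof.
move=> th0; rewrite /c_ex sem_c_F.
have leP k : sem k th (C_le (CT_const (Posz 1)) (CT_count (Posz 1) 0 (C_bind v g)))
    <-> exists2 j, j < k.+1 & sem j (upd th v j) g.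
  rewrite -(sum_pdec_gt0 (fun j => sem j (upd th v j) g)) [csem _ _ _ _]/= th0.
  by rewrite GRing.mul1r.
split=> [[k [_ /leP[j _ gj]]]|[j gj]]; first by exists j.
by exists (maxn i j); split; [lia | apply/leP; exists j => //; lia].
Qed.

(** The interval from [v] to the current position is empty exactly before [v], hence at as many
    positions as the value of [v]. This turns a value into a count. *)
Definition c_below (v : nat) : cform :=
  C_le (CT_count (Posz 1) v c_top) (CT_const (Posz 0)).

Fixpoint c_term (t : ph_term) : cterm :=
  match t with
  | PT_const a => CT_const (Posz a)
  | PT_mul a x => CT_count (Posz a) 0 (c_below x)
  | PT_add t1 t2 => CT_add (c_term t1) (c_term t2)
  end.

Lemma sum_top th m n : \sum_(m <= j < n) pdec (sem j th c_top) = n - m.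
Proof.
rewrite (eq_bigr (fun=> 1)) ?sum_nat_const_nat ?muln1 // => j _.
by rewrite pdec_true.
Qed.

Lemma sem_c_below v i th : sem i th (c_below v) <-> i < th v.
Proof. by rewrite /c_below [csem _ _ _ _]/= (sum_top th); split; lia. Qed.

Lemma sum_pdec_lt (P : nat -> Prop) m n : (forall j, P j <-> j < m) -> m <= n ->
  \sum_(0 <= j < n) pdec (P j) = m.
Proof.
move=> Pm mn; rewrite (@big_cat_nat _ _ _ m) //=.
rewrite (eq_big_nat _ _ (F2 := fun=> 1)); last first.
  by move=> j /andP[_ jm]; rewrite pdec_true //; apply/Pm.
rewrite sum_nat_const_nat big_nat big1 ?muln1 ?addn0 ?subn0 // => j /andP[mj _].
by rewrite (@pdecE _ false) // Pm; split=> //; lia.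
Qed.

(** A count sees only the positions up to the current one, so the value of a variable is complete
    only after enough positions have passed. *)
Lemma tsem_c_term t th : th 0 = 0 ->
  exists B, forall j, B <= j -> tsem j th (c_term t) = Posz (ph_eval th t).
Proof.
move=> th0; elim: t => [a|a x|t1 [B1 IH1] t2 [B2 IH2]].
- by exists 0.
- exists (th x) => j xj; rewrite [c_term _]/= tsem_count th0.
  by rewrite (@sum_pdec_lt _ (th x)) //; [move=> k; exact: sem_c_below | lia].
- exists (maxn B1 B2) => j; rewrite geq_max => /andP[h1 h2] /=.
  by rewrite IH1 // IH2.
Qed.

Definition c_leq (e : bool) (t1 t2 : cterm) : cform := c_FG e (C_le t1 t2).

(** Guards contain no translated subformula, so repeating their parts is harmless. They are
    quantifier-free; the quantified cases make the function total. *)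
Fixpoint c_qf (e : bool) (f : ph_form) : cform :=
  match f with
  | PH_le t1 t2 => c_leq e (c_term t1) (c_term t2)
  | PH_not g => C_not (c_qf e g)
  | PH_and g h => C_and (c_qf e g) (c_qf e h)
  | PH_ex _ g | PH_hartig _ _ g => c_qf e g
  end.

Fixpoint quantifier_free (f : ph_form) : bool :=
  match f with
  | PH_le _ _ => true
  | PH_not g => quantifier_free g
  | PH_and g h => quantifier_free g && quantifier_free h
  | _ => false
  end.

Lemma sem_c_qf e f i th : th 0 = 0 -> quantifier_free f ->
  sem i th (c_qf e f) <-> ph_holds th f.
Proof.
move=> th0; elim: f => [t1 t2 _|g IH /IH /= {}IH|g IHg h IHh|//|//].
- rewrite [c_qf _ _]/= /c_leq sem_c_FG.
  have [B1 h1] := tsem_c_term t1 th0; have [B2 h2] := tsem_c_term t2 th0.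
  have leP j : maxn B1 B2 <= j -> sem j th (C_le (c_term t1) (c_term t2)) <->
      ph_eval th t1 <= ph_eval th t2.
    by rewrite geq_max => /andP[j1 j2] /=; rewrite h1 // h2.
  split=> [[B h]|le12]; last by exists (maxn B1 B2) => j /leP->.
  by rewrite /= -(leP (maxn B (maxn B1 B2))) ?leq_maxr //; apply: h; lia.
- tauto.
- by move=> /= /andP[/IHg{}IHg /IHh{}IHh]; tauto.
Qed.

(** * Translation of Presburger arithmetic with Hartig quantifier *)

(** The number of elements up to N is monotone in N, so being eventually constant amounts to
    finiteness, and the constant is the cardinality. *)
Lemma hartig_count (P : nat -> Prop) n :
  (exists s : seq nat, uniq s /\ (forall b, b \in s <-> P b) /\ size s = n) <->
  exists B, forall N, B <= N -> \sum_(0 <= j < N.+1) pdec (P j) = n.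
Proof.
split=> [[s [us [sP <-]]]|[B h]].
  exists (\max_(j <- s) j) => N leN.
  transitivity (count (mem s) (index_iota 0 N.+1)).
    rewrite -sum1_count [RHS]big_mkcond; apply: eq_bigr => j _.
    by rewrite (@pdecE _ (j \in s)) -?sP //; case: (j \in s).
  rewrite -size_filter; apply/perm_size/uniq_perm => // [|j].
    by rewrite filter_uniq // iota_uniq.
  rewrite mem_filter mem_index_iota /= andb_idr // => js.
  by rewrite ltnS (leq_trans _ leN) // (big_rem _ js) /= leq_maxl.
exists [seq j <- index_iota 0 B.+1 | pdec (P j) == 1]; split; last split.
- by rewrite filter_uniq // iota_uniq.
- move=> b; rewrite mem_filter mem_index_iota /=.
  split=> [/andP[/eqP Pb _]|Pb]; first by apply/pdec_gt0; rewrite Pb.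
  rewrite pdec_true //= ltnS leqNgt; apply/negP => Bb.
  (* An element [b] beyond [B] would raise the count between N = b - 1 and N = b, although both
     counts are [n]. *)
  have := h b (ltnW Bb); rewrite big_nat_recr //= pdec_true //.
  by case: b Pb Bb => // b _ Bb; rewrite h //; lia.
- rewrite -(h B) // size_filter -sum1_count big_mkcond; apply: eq_bigr => j _.
  by have := pdec_le1 (P j); case: eqP => //; lia.
Qed.

(* The variable [x] of PH becomes [var x]; the even names are left for auxiliary
   variables, and the variable 0 is never bound, so that its value is 0. *)
Definition var (x : nat) : nat := x.*2.+1.

Notation vval := 2.
Notation vuni := 4.
Notation vpos := 6.
Notation vfst := 8.
Notation vsnd := 10.
Notation vcard := 12.
Notation vstart := 14.
Notation vbit := 16.
Notation vend := 18.
Notation vthr := 20.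

Definition env (th : nat -> nat) (x : nat) : nat := th (var x).

Lemma upd_same th v b : upd th v b v = b.
Proof. by rewrite /upd eqxx. Qed.

Lemma env_upd_aux th v b : ~~ odd v -> env (upd th v b) = env th.
Proof.
move=> ev; apply: functional_extensionality => x; rewrite /env /upd /var.
by case: eqP => // E; move: ev; rewrite -E /= odd_double.
Qed.

Lemma env_upd_var th x b : env (upd th (var x) b) = upd (env th) x b.
Proof.
by apply: functional_extensionality => y; rewrite /env /upd /var eqSS (inj_eq double_inj).
Qed.

Lemma upd_var_aux th x b v : ~~ odd v -> upd th (var x) b v = th v.
Proof.
by rewrite /upd /var; case: eqP => // ->; rewrite /= odd_double.
Qed.

(** A binder records the current position, so a value passes from one variable to another by binding
    at the position where the first was bound. Therefore evaluation at [th v] is singled out. *)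
Definition expresses_at (v : nat) (c : cform) (R : (nat -> nat) -> Prop) : Prop :=
  forall th, th 0 = 0 -> (sem (th v) th c <-> R th).

Definition expresses (c : cform) (R : (nat -> nat) -> Prop) : Prop :=
  forall i th, th 0 = 0 -> (sem i th c <-> R th).

Lemma expresses_here v c R : expresses c R -> expresses_at v c R.
Proof. by move=> h th; apply: h. Qed.

Lemma expresses_and_at v c d R Q : expresses_at v c R -> expresses_at v d Q ->
  expresses_at v (C_and c d) (fun th => R th /\ Q th).
Proof. by move=> h k th th0 /=; have := h th th0; have := k th th0; tauto. Qed.

Lemma expresses_and c d R Q : expresses c R -> expresses d Q ->
  expresses (C_and c d) (fun th => R th /\ Q th).
Proof. by move=> h k i th th0 /=; have := h i th th0; have := k i th th0; tauto. Qed.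

Lemma expresses_not c R : expresses c R -> expresses (C_not c) (fun th => ~ R th).
Proof. by move=> h i th th0 /=; have := h i th th0; tauto. Qed.

Lemma expresses_bind v x c R : expresses c R ->
  expresses_at v (C_bind (var x) c) (fun th => R (upd th (var x) (th v))).
Proof. by move=> h th th0; apply: h. Qed.

Lemma expresses_qf e f : quantifier_free f ->
  expresses (c_qf e f) (fun th => ph_holds th f).
Proof. by move=> qf i th th0; apply: sem_c_qf. Qed.

Lemma expresses_ex e v c R : v != 0 -> expresses_at v c R ->
  expresses (c_ex e v c) (fun th => exists j, R (upd th v j)).
Proof.
move=> v0 h i th th0; rewrite sem_c_ex //.
have hj j : sem j (upd th v j) c <-> R (upd th v j).
  by rewrite -h ?upd_same // /upd eq_sym (negbTE v0).
by split=> [[j /hj]|[j /hj]]; exists j.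
Qed.

Lemma expresses_all e v c R : v != 0 -> expresses c R ->
  expresses (c_all e v c) (fun th => forall j, R (upd th v j)).
Proof.
move=> v0 h i th th0.
rewrite (expresses_not (expresses_ex e v0 (expresses_here _ (expresses_not h))) _ th0).
split=> [nE j|hR [j]]; last exact.
by apply: NNPP => nR; apply: nE; exists j.
Qed.

Lemma eq_expresses c R Q : expresses c R ->
  (forall th, th 0 = 0 -> (R th <-> Q th)) -> expresses c Q.
Proof. by move=> h RQ i th th0; rewrite h // RQ. Qed.

(** * Presburger guards, rebinding and controlled quantifiers *)

Definition pvar (v : nat) : ph_term := PT_mul 1 v.
Definition ph_eq (t1 t2 : ph_term) : ph_form := PH_and (PH_le t1 t2) (PH_le t2 t1).
Definition ph_or (f g : ph_form) : ph_form := PH_not (PH_and (PH_not f) (PH_not g)).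
Definition ph_imp (f g : ph_form) : ph_form := PH_not (PH_and f (PH_not g)).
Definition ph_iff (f g : ph_form) : ph_form := PH_and (ph_imp f g) (ph_imp g f).
Definition ph_zero (v : nat) : ph_form := PH_le (pvar v) (PT_const 0).
Definition ph_nonzero (v : nat) : ph_form := PH_not (ph_zero v).

Lemma ph_holds_eq th t1 t2 : ph_holds th (ph_eq t1 t2) <-> ph_eval th t1 = ph_eval th t2.
Proof. by rewrite /=; lia. Qed.

Lemma ph_holds_imp th f g : ph_holds th (ph_imp f g) <-> (ph_holds th f -> ph_holds th g).
Proof. by rewrite /=; tauto. Qed.

Lemma ph_holds_or th f g : ph_holds th (ph_or f g) <-> (ph_holds th f \/ ph_holds th g).
Proof. by rewrite /=; tauto. Qed.

Lemma ph_holds_iff th f g : ph_holds th (ph_iff f g) <-> (ph_holds th f <-> ph_holds th g).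
Proof. by rewrite /=; tauto. Qed.

Lemma ph_holds_nonzero th v : ph_holds th (ph_nonzero v) <-> th v <> 0.
Proof. by rewrite /=; lia. Qed.

Lemma ph_eval_pvar th v : ph_eval th (pvar v) = th v.
Proof. exact: mul1n. Qed.

(** Assignment as quantification with an equation guard: [c] occurs once and last, as a translation
    in reading order requires. *)
Definition c_rebind (e : bool) (b : nat) (c : cform) : cform :=
  c_ex e vval (C_and (c_qf e (ph_eq (pvar vval) (pvar b))) c).

Lemma expresses_rebind e b c R : b != vval -> expresses c R ->
  expresses (c_rebind e b c) (fun th => R (upd th vval (th b))).
Proof.
move=> bv h; apply: eq_expresses.
  apply: expresses_ex => //; apply: expresses_here; apply: expresses_and (h).
  exact: expresses_qf.
move=> th th0; split=> [[j [/ph_holds_eq]]|hR].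
  by rewrite !ph_eval_pvar upd_same /upd (negbTE bv) => ->.
exists (th b); split=> //; apply/ph_holds_eq.
by rewrite !ph_eval_pvar upd_same /upd (negbTE bv).
Qed.

(** Values of the two children are guessed, and [q] only relates them to [vval]; so each child
    occurs once, whatever polarity is demanded of it. *)
Definition c_binary (e : bool) (q : ph_form) (c d : cform) : cform :=
  c_ex e vfst (c_ex e vsnd (C_and (c_qf e q)
    (C_and (c_rebind e vfst c) (c_rebind e vsnd d)))).

Lemma expresses_binary e q c d R Q : quantifier_free q ->
  expresses c R -> expresses d Q ->
  expresses (c_binary e q c d) (fun th => exists a b,
    let th' := upd (upd th vfst a) vsnd b in
    [/\ ph_holds th' q, R (upd th' vval a) & Q (upd th' vval b)]).
Proof.
move=> qq hc hd; apply: eq_expresses.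
  apply: expresses_ex => //; apply: expresses_here.
  apply: expresses_ex => //; apply: expresses_here.
  apply: expresses_and; first exact: expresses_qf.
  apply: expresses_and; [exact: expresses_rebind hc | exact: expresses_rebind hd].
move=> th th0; split=> [[a [b [h1 [h2 h3]]]]|[a [b [h1 h2 h3]]]];
  by exists a, b; split.
Qed.

(* [c_switch e true v c] is an existential quantification over [v] if
   [vval] is nonzero and a universal one otherwise; [c_switch e false] is dual. *)
Definition c_switch (e b : bool) (v : nat) (c : cform) : cform :=
  c_all e vuni (c_ex e v (C_and
    (c_qf e (ph_imp (if b then ph_zero vval else ph_nonzero vval)
                    (ph_eq (pvar v) (pvar vuni)))) c)).

(** For every [vuni] some [v] is chosen, and the guard forces [v] to equal [vuni] exactly when the
    universal reading is wanted. Otherwise [v] is free and [vuni] has no influence, since by the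
    last hypothesis [R] ignores it. *)
Lemma expresses_switch e (b : bool) v c R (Q : (nat -> nat) -> nat -> Prop) :
  v \notin [:: 0; vval; vuni] -> expresses_at v c R ->
  (forall th a j, R (upd (upd th vuni a) v j) <-> Q th j) ->
  expresses (c_switch e b v c) (fun th =>
    if b == (th vval == 0) then forall j, Q th j else exists j, Q th j).
Proof.
rewrite !inE !negb_or => /and3P[v0 v2 v4] hc hRQ; apply: eq_expresses.
  apply: expresses_all => //; apply: expresses_ex => //.
  apply: expresses_and_at (hc); apply: expresses_here.
  by apply: expresses_qf; case: b.
move=> th th0.
have guardP a j : ph_holds (upd (upd th vuni a) v j) (ph_imp (if b then ph_zero vval else ph_nonzero vval)
                         (ph_eq (pvar v) (pvar vuni))) <->
    (b == (th vval == 0) -> j = a).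
  rewrite ph_holds_imp ph_holds_eq !ph_eval_pvar upd_same.
  have -> : upd (upd th vuni a) v j vuni = a.
    by rewrite /upd eq_sym (negbTE v4).
  have valE : upd (upd th vuni a) v j vval = th vval.
    by rewrite /upd eq_sym (negbTE v2).
  by case: b; rewrite ?ph_holds_nonzero /= valE ?muln1 ?mul1n;
    case: (th vval) => [|n] /=; split=> h //; intuition.
case: (boolP (b == (th vval == 0))) => hb.
  split=> [h j|h a].
    by have [j' [/guardP-/(_ hb)-> /hRQ]] := h j.
  by exists a; split; [apply/guardP | apply/hRQ].
split=> [/(_ 0)[j [_ /hRQ]]|[j hj] a]; first by exists j.
by exists j; split; [apply/guardP => hb'; rewrite hb' in hb | apply/hRQ].
Qed.

(* At position [k], the inner count is at most 1 iff [k <= vend]. *)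
Definition c_count_ge (e : bool) (y : nat) (c : cform) : cform :=
  c_FG e (C_le (c_term (pvar vthr)) (CT_count (Posz 1) 0 (C_bind (var y)
    (C_and (C_le (CT_count (Posz 1) vend c_top) (CT_const (Posz 1))) c)))).

(** The guard discards all positions after [vend], so the count no longer changes once that position
    is passed, and the eventual comparison is one with the count up to [vend]. *)
Lemma expresses_count_ge e y c R : expresses c R ->
  expresses (c_count_ge e y c) (fun th =>
    th vthr <= \sum_(0 <= j < (th vend).+1) pdec (R (upd th (var y) j))).
Proof.
move=> hc i th th0; rewrite /c_count_ge sem_c_FG.
have [B thrE] := tsem_c_term (pvar vthr) th0.
have leP k : maxn B (th vend) <= k ->
  sem k th (C_le (c_term (pvar vthr)) (CT_count (Posz 1) 0 (C_bind (var y)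
    (C_and (C_le (CT_count (Posz 1) vend c_top) (CT_const (Posz 1))) c)))) <->
  th vthr <= \sum_(0 <= j < (th vend).+1) pdec (R (upd th (var y) j)).
  rewrite geq_max => /andP[Bk ek].
  rewrite sem_le thrE // ph_eval_pvar tsem_count th0 GRing.mul1r lez_nat.
  (* The binder equates the value of [var y] with the position [j] that is being counted. *)
  have bodyP j : sem j th (C_bind (var y)
      (C_and (C_le (CT_count (Posz 1) vend c_top) (CT_const (Posz 1))) c)) <->
      j <= th vend /\ R (upd th (var y) j).
    have := hc j _ (etrans (upd_var_aux th y j (isT : ~~ odd 0)) th0).
    rewrite /= upd_var_aux // (sum_top (upd th (var y) j)) => cP.
    by split=> [[jle /cP]|[jle /cP]]; split=> //; lia.
  rewrite (@big_cat_nat _ _ _ (th vend).+1) ?ltnS //.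
  rewrite [X in _ <= _ + X](_ : _ = 0) ?addn0; last first.
    rewrite big_nat big1 // => j /andP[je _]; apply: (@pdecE _ false).
    by rewrite bodyP; split=> // [[]]; lia.
  rewrite (eq_big_nat _ _ (F2 := fun j => pdec (R (upd th (var y) j)))) //.
  move=> j /andP[_ je]; apply: eq_pdec; rewrite bodyP.
  by split=> [[]|].
split=> [[B' h]|h]; last by exists (maxn B (th vend)) => k /leP->.
by rewrite -(leP (maxn B' (maxn B (th vend)))) ?leq_maxr //; apply: h; lia.
Qed.

(** * Translation of terms and formulas *)

Definition rel_le : ph_form :=
  ph_iff (ph_nonzero vval) (PH_le (pvar vfst) (pvar vsnd)).

Definition rel_and : ph_form :=
  ph_iff (ph_nonzero vval) (PH_and (ph_nonzero vfst) (ph_nonzero vsnd)).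

Definition rel_add : ph_form :=
  ph_eq (pvar vval) (PT_add (pvar vfst) (pvar vsnd)).

(* [vthr] is a lower bound to be met by the number of [k <= vend] satisfying the
   subformula if [vbit] is nonzero, and falsifying it otherwise. *)
Definition rel_hartig : ph_form :=
  ph_or
    (PH_and (ph_nonzero vval)
      (ph_or (PH_le (PT_add (pvar vend) (PT_const 1)) (pvar vstart))
        (ph_or
          (PH_and (ph_nonzero vbit) (PH_le (pvar vcard) (pvar vthr)))
          (PH_and (ph_zero vbit)
            (PH_le (PT_add (pvar vend) (PT_const 1))
                   (PT_add (pvar vthr) (pvar vcard)))))))
    (PH_and (ph_zero vval)
      (PH_and (PH_le (pvar vstart) (pvar vend))
        (ph_or
          (PH_and (ph_nonzero vbit)
            (PH_le (PT_add (pvar vcard) (PT_const 1)) (pvar vthr)))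
          (PH_and (ph_zero vbit)
            (PH_le (PT_add (pvar vend) (PT_const 2))
                   (PT_add (pvar vthr) (pvar vcard))))))).

(** With the detour through [vpos], a product mentions its numbers in the order a, a, x, x, so that
    each can be erased from the input before the next is read. *)
Fixpoint tr_term (e : bool) (t : ph_term) : cform :=
  match t with
  | PT_const a => c_qf e (ph_eq (pvar vval) (PT_const a))
  | PT_mul a x =>
      c_ex e vpos (C_and (c_qf e (ph_eq (pvar vval) (PT_mul a vpos)))
                         (c_qf e (ph_eq (pvar vpos) (pvar (var x)))))
  | PT_add t1 t2 => c_binary e rel_add (tr_term e t1) (tr_term e t2)
  end.

(* A subformula occurring once occurs with one polarity only, whereas the Hartig
   quantifier is not monotone. Hence [tr_form] expresses the equivalence of
   [f] with [vval <> 0], so that both polarities come from one occurrence. *)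
Fixpoint tr_form (e : bool) (f : ph_form) : cform :=
  match f with
  | PH_le t1 t2 => c_binary e rel_le (tr_term e t1) (tr_term e t2)
  | PH_not g => C_not (tr_form e g)
  | PH_and g h => c_binary e rel_and (tr_form e g) (tr_form e h)
  | PH_ex x g => c_switch e true vpos (C_bind (var x) (tr_form e g))
  | PH_hartig x y g =>
      c_ex e vcard (C_and (c_qf e (ph_eq (pvar vcard) (pvar (var x))))
        (c_switch e true vstart (c_switch e false vbit (c_switch e false vend
          (c_ex e vthr (C_and (c_qf e rel_hartig)
            (c_count_ge e y (c_rebind e vbit (tr_form e g)))))))))
  end.

Lemma tr_term_correct e t :
  expresses (tr_term e t) (fun th => th vval = ph_eval (env th) t).
Proof.
elim: t => [a|a x|t1 IH1 t2 IH2].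
- apply: eq_expresses (expresses_qf e _) _ => // th _.
  by rewrite ph_holds_eq ph_eval_pvar.
- apply: eq_expresses.
    apply: expresses_ex => //; apply: expresses_here.
    by apply: expresses_and; apply: expresses_qf.
  move=> th _; split=> [[j [/ph_holds_eq + /ph_holds_eq]]|h].
    rewrite /= !mul1n upd_same => vE xE; move: vE; rewrite {}xE.
    by rewrite -[upd _ _ _ (var x)]/(env _ x) env_upd_aux.
  exists (env th x); split; apply/ph_holds_eq; rewrite /= !mul1n upd_same //.
  by rewrite -[RHS]/(env _ x) env_upd_aux.
- apply: eq_expresses (expresses_binary e _ IH1 IH2) _ => // th _.
  split=> [[a [b [/ph_holds_eq + h2 h3]]]|h].
    move: h2 h3; rewrite /= !upd_same !env_upd_aux // => <- <-.
    by rewrite !mul1n.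
  exists (ph_eval (env th) t1), (ph_eval (env th) t2); split.
  - by apply/ph_holds_eq; rewrite /= !mul1n.
  - by rewrite upd_same !env_upd_aux.
  - by rewrite upd_same !env_upd_aux.
Qed.

(** * The Hartig quantifier in both polarities *)

Lemma truth_value (P : Prop) : P <-> pdec P <> 0.
Proof. by rewrite /pdec; case: excluded_middle_informative. Qed.

Lemma sum_pdec_le (P : nat -> Prop) n : \sum_(0 <= j < n) pdec (P j) <= n.
Proof.
rewrite -[leqRHS](_ : \sum_(0 <= j < n) 1 = n).
  by apply: leq_sum => j _; apply: pdec_le1.
by rewrite sum_nat_const_nat muln1 subn0.
Qed.

Lemma sum_pdec_not (P : nat -> Prop) n :
  \sum_(0 <= j < n) pdec (~ P j) = n - \sum_(0 <= j < n) pdec (P j).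
Proof.
elim: n => [|n IH]; first by rewrite !big_geq.
rewrite !big_nat_recr //= IH pdec_not.
have := pdec_le1 (P n); have := sum_pdec_le P n; lia.
Qed.

(* The count taken by [c_count_ge] when [vbit] is [s]. *)
Definition sided_count (P : nat -> Prop) (s n : nat) : nat :=
  \sum_(0 <= j < n) pdec (P j <-> s <> 0).

Lemma sided_count0 P n : sided_count P 0 n = n - \sum_(0 <= j < n) pdec (P j).
Proof.
rewrite -sum_pdec_not; apply: eq_bigr => j _; apply: eq_pdec.
by split=> [h /h|h] //; split=> // /h.
Qed.

Lemma sided_countS P s n : sided_count P s.+1 n = \sum_(0 <= j < n) pdec (P j).
Proof.
apply: eq_bigr => j _; apply: eq_pdec.
by split=> [h|p]; [apply/h | split].
Qed.

(** Of the N + 1 candidates, at most x satisfy iff at least N + 1 - x falsify; the form N < m + x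
    avoids truncated subtraction. For w = 0 the same bounds are made strict, so that either of them
    refutes equality. *)
Definition threshold_rel (w x B s N m : nat) : Prop :=
  (w <> 0 /\ (N < B \/ (s <> 0 /\ x <= m) \/ (s = 0 /\ N < m + x))) \/
  (w = 0 /\ B <= N /\ ((s <> 0 /\ x < m) \/ (s = 0 /\ N.+1 < m + x))).

(** Equality with [x] is the conjunction of the bounds for s = 0 and s <> 0, its failure the
    disjunction of the strict ones. So [s] and [N] are both universal for w <> 0 and existential for
    w = 0, while [B] is quantified the opposite way. *)
Lemma hartig_switch (P : nat -> Prop) (w x : nat) (Q : nat -> nat -> nat -> Prop) :
  (forall B s N, Q B s N <->
     exists m, threshold_rel w x B s N m /\ m <= sided_count P s N.+1) ->
  (if w == 0
   then forall B, exists s, exists N, Q B s N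
   else exists B, forall s, forall N, Q B s N) <->
  ((exists B, forall N, B <= N -> \sum_(0 <= j < N.+1) pdec (P j) = x) <-> w <> 0).
Proof.
move=> QP; set E := exists B, forall N, B <= N -> _.
have cle N := sum_pdec_le P N.
case: (eqVneq w 0) => [w0|/eqP w0]; last first.
  suff: (exists B, forall s N, Q B s N) <-> E by rewrite /=; tauto.
  split=> [[B h]|[B h]]; exists B.
    (* The instance s = 0 bounds the count from above, s = 1 from below. *)
    move=> N BN; have /QP[m0 [t0 l0]] := h 0 N; have /QP[m1 [t1 l1]] := h 1 N.
    move: l0 l1; rewrite sided_count0 sided_countS.
    move: t0 t1; rewrite /threshold_rel; have := cle N.+1; lia.
  move=> s N; apply/QP; case: (ltnP N B) => [NB|BN].
    (* Below [B] nothing is claimed, so the trivial threshold will do. *)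
    by exists 0; split=> //; left; split=> //; left.
  exists (sided_count P s N.+1); split=> //; left; split=> //; right.
  have := h N BN; have := cle N.+1; case: s => [|s].
    by rewrite sided_count0; lia.
  by rewrite sided_countS; lia.
suff: (forall B, exists s N, Q B s N) <-> ~ E by rewrite /=; tauto.
split=> [h [B hB]|nE B].
  have [s [N /QP[m [t l]]]] := h B.
  move: t l; rewrite /threshold_rel; case: s => [|s].
    by rewrite sided_count0; have := hB N; have := cle N.+1; lia.
  by rewrite sided_countS; have := hB N; lia.
have [N] : exists N, ~ (B <= N -> \sum_(0 <= j < N.+1) pdec (P j) = x).
  by apply: NNPP => h; apply: nE; exists B => N BN; apply: NNPP => ne; apply: h; exists N; auto.
move=> h; case: (leqP B N) => BN; last by case: h; lia.
case: (ltngtP (\sum_(0 <= j < N.+1) pdec (P j)) x) => [lt|gt|eq]; last by case: h.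
  (* Too few satisfying elements show up as too many falsifying ones, hence side 0. *)
  exists 0, N; apply/QP; exists (sided_count P 0 N.+1); split=> //.
  by rewrite sided_count0 /threshold_rel; have := cle N.+1; lia.
exists 1, N; apply/QP; exists (sided_count P 1 N.+1); split=> //.
by rewrite sided_countS /threshold_rel; lia.
Qed.

Definition counted (f : ph_form) (eta : nat -> nat) (y w x B s N : nat) : Prop :=
  exists m, threshold_rel w x B s N m /\
    m <= sided_count (fun j => ph_holds (upd eta y j) f) s N.+1.

Lemma holds_rel_hartig th : ph_holds th rel_hartig <->
  threshold_rel (th vval) (th vcard) (th vstart) (th vbit) (th vend) (th vthr).
Proof.
rewrite /rel_hartig /threshold_rel.
rewrite !(ph_holds_or, =^~ ph_holds_nonzero) /= !mul1n; lia.
Qed.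

Lemma holds_rel_and th a b : ph_holds (upd (upd th vfst a) vsnd b) rel_and <->
  (th vval <> 0 <-> a <> 0 /\ b <> 0).
Proof.
set th' := upd _ _ _.
have n0 : ph_holds th' (ph_nonzero vval) <-> th vval <> 0 := ph_holds_nonzero _ vval.
have n1 : ph_holds th' (ph_nonzero vfst) <-> a <> 0 := ph_holds_nonzero _ vfst.
have n2 : ph_holds th' (ph_nonzero vsnd) <-> b <> 0 := ph_holds_nonzero _ vsnd.
have n12 : ph_holds th' (PH_and (ph_nonzero vfst) (ph_nonzero vsnd)) <->
    a <> 0 /\ b <> 0.
  by split=> [[/n1 ? /n2 ?]|[/n1 ? /n2 ?]].
by rewrite ph_holds_iff; move: n0 n12; tauto.
Qed.

Lemma tr_form_correct e f :
  expresses (tr_form e f) (fun th => ph_holds (env th) f <-> th vval <> 0).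
Proof.
elim: f => [t1 t2|g IH|g IHg h IHh|x g IH|x y g IH].
- apply: eq_expresses
    (expresses_binary e _ (tr_term_correct e t1) (tr_term_correct e t2)) _ => // th _.
  split=> [[a [b [/ph_holds_iff]]]|h].
    by rewrite ph_holds_nonzero /= !mul1n !upd_same !env_upd_aux // => + <- <-; tauto.
  exists (ph_eval (env th) t1), (ph_eval (env th) t2); split.
  + by apply/ph_holds_iff; rewrite ph_holds_nonzero /= !mul1n; apply: iff_sym.
  + by rewrite upd_same !env_upd_aux.
  + by rewrite upd_same !env_upd_aux.
(* Negating an equivalence negates one of its sides, so negation commutes with the translation and
   [vval] is kept. *)
- apply: eq_expresses (expresses_not IH) _ => th _ /=.
  by case: (classic (ph_holds (env th) g)); tauto.
- apply: eq_expresses (expresses_binary e _ IHg IHh) _ => // th _.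
  split=> [[a [b [/holds_rel_and]]]|hgh].
    by rewrite !upd_same !env_upd_aux //=; tauto.
  (* The guessed values of the children are their truth values. *)
  exists (pdec (ph_holds (env th) g)), (pdec (ph_holds (env th) h)); split.
  + by apply/holds_rel_and; rewrite -!truth_value; apply: iff_sym.
  + by rewrite upd_same !env_upd_aux // -truth_value.
  + by rewrite upd_same !env_upd_aux // -truth_value.
(* Some instance has to hold if [vval] is nonzero, and all have to fail otherwise: each instance is
   compared with the same [vval], only the quantifier changes. *)
- apply: eq_expresses.
    apply: (@expresses_switch e true vpos _ _
      (fun th j => ph_holds (upd (env th) x j) g <-> th vval <> 0)) => //.
      exact: expresses_bind IH.
    move=> th a j; rewrite /= upd_var_aux // env_upd_var !env_upd_aux //.
  move=> th _ /=; case: (eqVneq (th vval) 0) => [w0|/eqP w0] /=; last first.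
    by split=> [[j h]|[h1 h2]]; [split=> // _; exists j; tauto | have [j] := h2 w0; exists j; tauto].
  split=> [h|h j]; first by split=> // [[j]]; have := h j; tauto.
  by split=> // hj; apply/h; exists j.
- have hin : expresses (c_ex e vthr (C_and (c_qf e rel_hartig)
      (c_count_ge e y (c_rebind e vbit (tr_form e g)))))
      (fun th => counted g (env th) y (th vval) (th vcard) (th vstart) (th vbit) (th vend)).
    apply: eq_expresses.
      apply: expresses_ex => //; apply: expresses_here; apply: expresses_and.
        exact: expresses_qf.
      by apply: expresses_count_ge; apply: expresses_rebind IH.
    have cE th m : upd th vthr m vthr <= \sum_(0 <= j < (upd th vthr m vend).+1)
        pdec (ph_holds (env (upd (upd (upd th vthr m) (var y) j) vval
                (upd (upd th vthr m) (var y) j vbit))) g <->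
              upd (upd (upd th vthr m) (var y) j) vval
                (upd (upd th vthr m) (var y) j vbit) vval <> 0) <->
        m <= sided_count (fun j => ph_holds (upd (env th) y j) g) (th vbit) (th vend).+1.
      rewrite upd_same -[upd _ _ _ vend]/(th vend) /sided_count.
      rewrite (eq_bigr (fun j => pdec (ph_holds (upd (env th) y j) g <-> th vbit <> 0))) //.
      move=> j _; rewrite upd_same env_upd_aux // env_upd_var env_upd_aux //.
      by rewrite upd_var_aux.
    by move=> th _; split=> [[m [/holds_rel_hartig h /cE]]|[m [h /cE]]];
      exists m; split=> //; apply/holds_rel_hartig.
  (* From the innermost switch outwards, [Q3], [Q2] and [Q1] read fewer and fewer auxiliary
     variables from [th]: those of the inner switches are already quantified. *)
  pose Q3 th N := counted g (env th) y (th vval) (th vcard) (th vstart) (th vbit) N.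
  have h3 := @expresses_switch e false vend _ _ Q3 isT (expresses_here _ hin) _.
  pose Q2 th s := if false == (th vval == 0)
    then forall N, counted g (env th) y (th vval) (th vcard) (th vstart) s N
    else exists N, counted g (env th) y (th vval) (th vcard) (th vstart) s N.
  have h2 := @expresses_switch e false vbit _ _ Q2 isT (expresses_here _ (h3 _)) _.
  pose Q1 th B := if false == (th vval == 0)
    then forall s, (if false == (th vval == 0)
      then forall N, counted g (env th) y (th vval) (th vcard) B s N
      else exists N, counted g (env th) y (th vval) (th vcard) B s N)
    else exists s, (if false == (th vval == 0)
      then forall N, counted g (env th) y (th vval) (th vcard) B s N
      else exists N, counted g (env th) y (th vval) (th vcard) B s N).
  have h1 := @expresses_switch e true vstart _ _ Q1 isT (expresses_here _ (h2 _ _)) _.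
  apply: eq_expresses.
    apply: expresses_ex => //; apply: expresses_here; apply: expresses_and.
      exact: expresses_qf.
    apply: h1.
    + by move=> th a j; rewrite /Q3 !env_upd_aux.
    + by move=> th a j; rewrite /Q2 /Q3 !env_upd_aux.
    + by move=> th a j; rewrite /Q1 /Q2 /Q3 !env_upd_aux.
  move=> th _; cbv beta delta [Q1].
  have HS := @hartig_switch (fun j => ph_holds (upd (env th) y j) g) (th vval) (env th x)
    (counted g (env th) y (th vval) (env th x)) (fun _ _ _ => iff_refl _).
  apply: iff_trans (iff_trans HS _); last by rewrite -hartig_count.
  split=> [[j [/ph_holds_eq]]|h].
    rewrite !ph_eval_pvar upd_same -[upd _ _ _ (var x)]/(env _ x) !env_upd_aux // => ->.
    by rewrite -[upd _ _ _ vval]/(th vval);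
       case: (th vval == 0).
  exists (env th x); split.
    by apply/ph_holds_eq; rewrite !ph_eval_pvar upd_same -[RHS]/(env _ x) env_upd_aux.
  rewrite !env_upd_aux // upd_same -[upd _ _ _ vval]/(th vval).
  by move: h; case: (th vval == 0).
Qed.

(** * Streaming programs and Turing machines *)

(** Control returns to an earlier point only through [Jump] or the alternation of an instruction
    with its [Bit] companion. So finitely many programs are reachable, and they can serve as machine
    states. *)
Inductive prog : Type :=
| Halt
| Fin
| Jump of bool
| Emit of bool & prog
| Copy of prog
| CopyBit of prog
| Rewind of prog
| Drop of prog
| DropBit of prog
| Pop of prog & prog
| Inc of prog
| Dec of prog
| Test of prog & prog
| IfEnd of prog & prog.

Lemma prog_comparable : comparable prog.
Proof. by rewrite /comparable /decidable; decide equality; decide equality. Qed.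

HB.instance Definition _ := hasDecEq.Build prog (compareP prog_comparable).

Definition hconf : Type := (prog * nat * seq bool * seq bool * seq bool)%type.

(* In [(p, k, u, v, o)], [k] is a counter, [u ++ v] is the unread input with the
   head in front of [v], and [o] is the output. [Copy] copies a number (in the
   format of [enc_nat]) to the output, [Drop] erases one. *)
Definition hstep (body : bool -> prog) (c : hconf) : option hconf :=
  let '(p, k, u, v, o) := c in
  match p, u, v with
  | Jump b, _, _ => Some (body b, k, u, v, o)
  | Emit b q, _, _ :: _ => Some (q, k, u, v, rcons o b)
  | Copy q, _, x :: v' =>
      Some (if x then CopyBit q else q, k, rcons u x, v', rcons o x)
  | CopyBit q, _, x :: v' => Some (Copy q, k, rcons u x, v', rcons o x)
  | Rewind q, _, _ => Some (q, k, [::], u ++ v, o)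
  | Drop q, [::], x :: v' => Some (if x then DropBit q else q, k, u, v', o)
  | DropBit q, [::], x :: v' => Some (Drop q, k, u, v', o)
  | Pop q0 q1, [::], x :: v' => Some (if x then q1 else q0, k, u, v', o)
  | Inc q, [::], _ => Some (q, k.+1, u, v, o)
  | Dec q, [::], _ => if k is k'.+1 then Some (q, k', u, v, o) else None
  | Test q0 q1, [::], _ => Some (if k is 0 then q0 else q1, k, u, v, o)
  | IfEnd q0 q1, _, _ => Some (if v is [::] then q0 else q1, k, u, v, o)
  | _, _, _ => None
  end.

(** * Machine transitions of the instructions *)

Notation sym := (option bool).
Notation state := (prog * (nat * bool))%type.
Notation action := (option (state * sym * bool)).

(* The cell under the head is blanked to find it again after the excursion to
   the end of the output; its contents [c] are kept in the state. *)
Definition append_delta (p : prog) (b : bool -> bool) (fin : action) (i : nat)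
    (c : bool) (h : sym) : action :=
  match i, h with
  | 0, Some x => Some ((p, (1, x)), None, true)
  | 1, Some x => Some ((p, (1, c)), Some x, true)
  | 1, None => Some ((p, (2, c)), None, true)
  | 2, Some x => Some ((p, (2, c)), Some x, true)
  | 2, None => Some ((p, (3, c)), Some (b c), false)
  | 3, Some x => Some ((p, (3, c)), Some x, false)
  | 3, None => Some ((p, (4, c)), None, false)
  | 4, Some x => Some ((p, (4, c)), Some x, false)
  | 4, None => fin
  | _, _ => None
  end.

(** Phases start at 2 because 0 and 1 belong to the calling instruction, which brings the head to
    the counter. *)
Definition erase_delta (p : prog) (q : prog) (i : nat) (c : bool) (h : sym) : action :=
  match i, h with
  | 2, Some x => Some ((p, (2, c)), Some x, false)
  | 2, None => Some ((p, (3, c)), None, true)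
  | 3, _ => Some ((p, (4, c)), None, true)
  | 4, Some x => Some ((p, (4, c)), Some x, true)
  | 4, None => Some ((q, (0, false)), None, true)
  | _, _ => None
  end.

(* The consumed cell becomes the blank between counter and input, the former such
   blank becomes a 1, and [erase_delta] removes the leftmost 1: the counter has
   moved one cell to the right. *)
Definition pop_delta (p : prog) (q : bool -> prog) (i : nat) (c : bool)
    (h : sym) : action :=
  match i, h with
  | 0, Some x => Some ((p, (1, x)), None, false)
  | 1, _ => Some ((p, (2, c)), Some true, false)
  | _, _ => erase_delta p (q c) i c h
  end.

(** A state is a program with a phase and one remembered bit. The head moves at every step, so
    staying in place takes a step to the left and one back. *)
Definition delta (body : bool -> prog) (s : state) (h : sym) : action :=
  let '(p, (i, c)) := s in
  match p with
  | Halt => None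
  | Fin => Some ((Halt, (0, false)), h, true)
  | Jump b =>
      if i is 0 then Some ((p, (1, false)), h, false)
      else Some ((body b, (0, false)), h, true)
  | Emit b q =>
      if i == 5 then Some ((q, (0, false)), h, false)
      else append_delta p (fun=> b) (Some ((p, (5, c)), Some c, true)) i c h
  | Copy q =>
      append_delta p id
        (Some ((if c then CopyBit q else q, (0, false)), Some c, true)) i c h
  | CopyBit q => append_delta p id (Some ((Copy q, (0, false)), Some c, true)) i c h
  | Rewind q =>
      match i, h with
      | 0, _ => Some ((p, (1, false)), h, false)
      | _, Some x => Some ((p, (1, false)), h, false)
      | _, None => Some ((q, (0, false)), h, true)
      end
  | Drop q => pop_delta p (fun x => if x then DropBit q else q) i c h
  | DropBit q => pop_delta p (fun=> Drop q) i c h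
  | Pop q0 q1 => pop_delta p (fun x => if x then q1 else q0) i c h
  | Inc q =>
      match i, h with
      | 0, _ => Some ((p, (1, false)), h, false)
      | 1, _ => Some ((p, (2, false)), h, false)
      | 2, Some x => Some ((p, (2, false)), h, false)
      | 2, None => Some ((p, (3, false)), Some true, true)
      | _, Some x => Some ((p, (3, false)), h, true)
      | _, None => Some ((q, (0, false)), h, true)
      end
  | Dec q =>
      match i with
      | 0 => Some ((p, (1, false)), h, false)
      | 1 => Some ((p, (2, false)), h, false)
      | _ => erase_delta p q i c h
      end
  | Test q0 q1 =>
      match i with
      | 0 => Some ((p, (1, false)), h, false)
      | 1 => Some ((p, (2, false)), h, false)
      | 2 => Some ((p, (3, h != None)), h, true)
      | _ => Some ((if c then q1 else q0, (0, false)), h, true)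
      end
  | IfEnd q0 q1 =>
      match i with
      | 0 => Some ((p, (1, h != None)), h, false)
      | _ => Some ((if c then q1 else q0, (0, false)), h, true)
      end
  end.

Notation sconf := (state * seq sym * sym * seq sym)%type.

Definition sstep (body : bool -> prog) (c : sconf) : option sconf :=
  let '(s, L, h, R) := c in
  match delta body s h with
  | None => None
  | Some (s', w, true) => Some (s', w :: L, head None R, behead R)
  | Some (s', w, false) => Some (s', behead L, head None L, w :: R)
  end.

Fixpoint srun (body : bool -> prog) (n : nat) (c : sconf) : sconf :=
  if n is n'.+1 then
    if sstep body c is Some c' then srun body n' c' else c
  else c.

Lemma srun_add body m n c : srun body (m + n) c = srun body n (srun body m c).
Proof.
elim: m c => //= m IH c; case E: (sstep body c) => [c'|]; first exact: IH.
by case: n {IH} => //= n; rewrite E.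
Qed.

(* Moving off an end of the tape and back leaves an explicit blank there, so
   tapes are compared up to trailing blanks. *)
Definition teq (s t : seq sym) : Prop := forall i, nth None s i = nth None t i.

Definition ceq (c d : sconf) : Prop :=
  let '(s, L, h, R) := c in let '(s', L', h', R') := d in
  [/\ s = s', teq L L', h = h' & teq R R'].

Lemma teq_cons x s t : teq s t -> teq (x :: s) (x :: t).
Proof. by move=> h [|i] /=. Qed.

Lemma teq_cat s t t' : teq t t' -> teq (s ++ t) (s ++ t').
Proof. by move=> h; elim: s => //= x s IH; apply: teq_cons. Qed.

Lemma teq_behead s t : teq s t -> teq (behead s) (behead t).
Proof. by move=> h i; rewrite !nth_behead. Qed.

Lemma teq_head s t : teq s t -> head None s = head None t.
Proof. by move=> h; rewrite -!nth0. Qed.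

Lemma teq_sym s t : teq s t -> teq t s.
Proof. by move=> h i. Qed.

Lemma teq_nil n : teq (nseq n None) [::].
Proof. by move=> i; rewrite nth_nseq nth_nil if_same. Qed.

Lemma ceq_trans c d e : ceq c d -> ceq d e -> ceq c e.
Proof.
case: c d e => [[[s L] h] R] [[[s' L'] h'] R'] [[[s'' L''] h''] R''].
move=> [-> hL -> hR] [-> hL' -> hR']; split=> // i; first by rewrite hL hL'.
by rewrite hR hR'.
Qed.

Lemma ceq_refl c : ceq c c.
Proof. by case: c => [[[s L] h] R]; split. Qed.

Lemma srun_ceq body n c d : ceq c d -> ceq (srun body n c) (srun body n d).
Proof.
elim: n c d => //= n IH [[[s L] h] R] [[[s' L'] h'] R'] E.
case: (E) => <- hL <- hR /=; case: (delta body s h) => [[[s1 w] []]|] //.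
  by apply: IH; split; rewrite ?(teq_head hR) //; [apply: teq_cons|apply: teq_behead].
by apply: IH; split; rewrite ?(teq_head hL) //; [apply: teq_behead|apply: teq_cons].
Qed.

Definition reach (body : bool -> prog) (n : nat) (c d : sconf) : Prop :=
  exists2 m, m <= n & ceq (srun body m c) d.

Lemma reach_trans body m n c d e :
  reach body m c d -> reach body n d e -> reach body (m + n) c e.
Proof.
move=> [i im cd] [j jn de]; exists (i + j); first exact: leq_add.
by rewrite srun_add; apply: ceq_trans de; apply: srun_ceq.
Qed.

Lemma reach_le body m n c d : m <= n -> reach body m c d -> reach body n c d.
Proof. by move=> mn [i im cd]; exists i => //; apply: leq_trans mn. Qed.

Lemma reach_ceq body c d : ceq c d -> reach body 0 c d.
Proof. by exists 0. Qed.

Lemma reach_step body n c c' d : sstep body c = Some c' ->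
  reach body n c' d -> reach body n.+1 c d.
Proof. by move=> E [i il h]; exists i.+1; rewrite //= E. Qed.

(** The scanned cell is put back in front of the half that is being swept, so that sweeps can be
    stated by concatenation. *)
Definition at_right (s : state) (L T : seq sym) : sconf := (s, L, head None T, behead T).
Definition at_left (s : state) (T R : seq sym) : sconf := (s, behead T, head None T, R).

Lemma ceq_right s L T L' T' : teq L L' -> teq T T' -> ceq (at_right s L T) (at_right s L' T').
Proof. by move=> hL hT; split=> //; [apply: teq_head | apply: teq_behead]. Qed.

Lemma ceq_left s T R T' R' : teq T T' -> teq R R' -> ceq (at_left s T R) (at_left s T' R').
Proof. by move=> hL hT; split=> //; [apply: teq_behead | apply: teq_head]. Qed.

Lemma scan_right body s w L T :
  (forall x, delta body s (Some x) = Some (s, Some x, true)) ->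
  reach body (size w) (at_right s L (map Some w ++ T))
    (at_right s (rev (map Some w) ++ L) T).
Proof.
move=> ds; elim: w L => [|x w IH] L; first exact/reach_ceq/ceq_refl.
apply: reach_step; first by rewrite /= ds.
by rewrite rev_cons cat_rcons; apply: IH.
Qed.

Lemma scan_left body s w T R :
  (forall x, delta body s (Some x) = Some (s, Some x, false)) ->
  reach body (size w) (at_left s (map Some w ++ T) R)
    (at_left s T (rev (map Some w) ++ R)).
Proof.
move=> ds; elim: w R => [|x w IH] R; first exact/reach_ceq/ceq_refl.
apply: reach_step; first by rewrite /= ds.
by rewrite rev_cons cat_rcons; apply: IH.
Qed.

Lemma step_right body s s' w L T :
  delta body s (head None T) = Some (s', w, true) ->
  reach body 1 (at_right s L T) (at_right s' (w :: L) (behead T)).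
Proof. by move=> ds; apply: reach_step; [rewrite /= ds | apply/reach_ceq/ceq_refl]. Qed.

Lemma turn_left body s s' w L T :
  delta body s (head None T) = Some (s', w, false) ->
  reach body 1 (at_right s L T) (at_left s' L (w :: behead T)).
Proof. by move=> ds; apply: reach_step; [rewrite /= ds | apply/reach_ceq/ceq_refl]. Qed.

Lemma step_left body s s' w T R :
  delta body s (head None T) = Some (s', w, false) ->
  reach body 1 (at_left s T R) (at_left s' (behead T) (w :: R)).
Proof. by move=> ds; apply: reach_step; [rewrite /= ds | apply/reach_ceq/ceq_refl]. Qed.

Lemma turn_right body s s' w T R :
  delta body s (head None T) = Some (s', w, true) ->
  reach body 1 (at_left s T R) (at_right s' (w :: behead T) R).
Proof. by move=> ds; apply: reach_step; [rewrite /= ds | apply/reach_ceq/ceq_refl]. Qed.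

(** * Simulation of single instructions *)

Definition ones (k : nat) : seq sym := map Some (nseq k true).

Lemma rev_ones k : rev (ones k) = ones k.
Proof. by rewrite /ones -map_rev rev_nseq. Qed.

Lemma ones_cons k : ones k ++ [:: Some true] = ones k.+1.
Proof. by elim: k => //= k ->. Qed.

(* From left to right the tape contains [1^k], a blank, [u ++ v], a blank and [o]. *)
Definition layout (c : hconf) : sconf :=
  let '(p, k, u, v, o) := c in
  at_right (p, (0, false)) (rev (map Some u) ++ None :: ones k)
    (map Some v ++ None :: map Some o).

Lemma reach_append body p b fin c A v o :
  (forall i h, i < 5 -> delta body (p, (i, c)) h = append_delta p b fin i c h) ->
  delta body (p, (0, false)) (Some c) = Some ((p, (1, c)), None, true) ->
  reach body (2 * (size v + size o) + 5)
    (at_right (p, (0, false)) A (Some c :: map Some v ++ None :: map Some o))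
    (at_left (p, (4, c)) (None :: A)
      (map Some v ++ None :: map Some (rcons o (b c)))).
Proof.
move=> d d0.
have -> : 2 * (size v + size o) + 5 =
  1 + (size v + (1 + (size o + (0 + (1 + (size (rev o) + (1 + (size (rev v) + 1)))))))).
  by rewrite !size_rev; lia.
apply: reach_trans (step_right (T := Some c :: _) _ d0) _ => /=.
apply: reach_trans; first by apply: scan_right => x; rewrite d.
apply: reach_trans; first by apply: step_right; rewrite d.
rewrite /= -[map Some o]cats0.
apply: reach_trans; first by apply: scan_right => x; rewrite d.
(* The free cell after the output lies beyond the end of the list; it is made an explicit blank. *)
apply: reach_trans.
  by apply/reach_ceq/(ceq_right _ (fun=> erefl))/(teq_sym (teq_nil 1)).
apply: reach_trans; first by apply: turn_left; rewrite d.
rewrite /= -map_rev.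
apply: reach_trans; first by apply: scan_left => x; rewrite d.
apply: reach_trans; first by apply: step_left; rewrite d.
rewrite /= -map_rev.
apply: reach_trans; first by apply: scan_left => x; rewrite d.
rewrite -!map_rev !revK map_rcons cats1.
by apply: reach_le (reach_ceq _ (ceq_refl _)).
Qed.

(** The head enters on the last of the [a] ones (or on the blank before them). A consumed input bit
    leads here with b = 1, the separator just turned into a one, and [Dec] with b = 0. *)
Lemma reach_erase body p q c a b k R : a + b = k.+1 ->
  (forall i h, 2 <= i <= 4 -> delta body (p, (i, c)) h = erase_delta p q i c h) ->
  reach body (2 * k + 5) (at_left (p, (2, c)) (ones a) (ones b ++ None :: R))
    (at_right (q, (0, false)) (None :: ones k) R).
Proof.
move=> abk d; apply: (@reach_le _ (size (nseq a true) +
    (0 + (1 + (1 + (size (nseq k true) + (1 + 0))))))).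
  by rewrite !size_nseq; lia.
rewrite -[ones a]cats0.
apply: reach_trans; first by apply: scan_left => x; rewrite d.
apply: reach_trans.
  by apply/reach_ceq/(ceq_left _ _ (fun=> erefl))/(teq_sym (teq_nil 1)).
apply: reach_trans; first by apply: turn_right; rewrite d.
rewrite -/(ones _) rev_ones catA /ones -map_cat -nseqD abk /=.
apply: reach_trans; first by apply: step_right; rewrite d.
apply: reach_trans; first by apply: scan_right => x; rewrite d.
apply: reach_trans; first by apply: step_right; rewrite d.
apply/reach_ceq/ceq_right => //.
rewrite -/(ones _) rev_ones -[in X in teq _ X](cats0 (ones k)).
(* The erased one and the blank before it are trailing blanks of the left half. *)
by apply/teq_cons/teq_cat/(teq_nil 2).
Qed.

Lemma reach_pop body p q c k v o :
  (forall i h, i < 5 -> delta body (p, (i, c)) h = pop_delta p q i c h) ->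
  delta body (p, (0, false)) (Some c) = Some ((p, (1, c)), None, false) ->
  reach body (2 * k + 7) (layout (p, k, [::], c :: v, o)) (layout (q c, k, [::], v, o)).
Proof.
move=> d d0; have -> : 2 * k + 7 = 1 + (1 + (2 * k + 5)) by lia.
apply: reach_trans (turn_left (T := Some c :: _) _ d0) _ => /=.
apply: reach_trans; first by apply: step_left; rewrite d.
apply: (@reach_erase _ _ _ _ _ 1); first by rewrite addn1.
by move=> i h /andP[i2 i4]; rewrite d //; case: i i2 i4 => [|[]].
Qed.

Lemma reach_copy body p q x k u v o :
  (forall i h, i < 5 -> delta body (p, (i, x)) h =
     append_delta p id (Some ((q, (0, false)), Some x, true)) i x h) ->
  delta body (p, (0, false)) (Some x) = Some ((p, (1, x)), None, true) ->
  reach body (2 * (size v + size o) + 6) (layout (p, k, u, x :: v, o))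
    (layout (q, k, rcons u x, v, rcons o x)).
Proof.
move=> dE d0; rewrite -[6]/(5 + 1) addnA.
apply: reach_trans (reach_append _ _ _ dE d0) _.
rewrite /layout (map_rcons _ u) rev_rcons.
by apply: turn_right; rewrite dE.
Qed.

Lemma reach_emit body b q x k u v o :
  reach body (2 * (size v + size o) + 7) (layout (Emit b q, k, u, x :: v, o))
    (layout (q, k, u, x :: v, rcons o b)).
Proof.
have dE i h : i < 5 -> delta body (Emit b q, (i, x)) h =
    append_delta (Emit b q) (fun=> b) (Some ((Emit b q, (5, x)), Some x, true)) i x h.
  by case: i => [|[|[|[|[|[]]]]]].
rewrite -[7]/(5 + (1 + 1)) addnA.
apply: reach_trans (reach_append _ _ _ dE (erefl _)) _.
apply: reach_trans; first by apply: turn_right; rewrite dE.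
apply: (@reach_trans _ 1 0); first by apply: turn_left.
rewrite /at_left /layout /at_right /=.
by apply/reach_ceq; case: v.
Qed.

Lemma reach_nudge body p p1 q k u v o :
  delta body (p, (0, false)) (head None (map Some v)) =
    Some (p1, head None (map Some v), false) ->
  (forall h, delta body p1 h = Some ((q, (0, false)), h, true)) ->
  reach body 2 (layout (p, k, u, v, o)) (layout (q, k, u, v, o)).
Proof.
move=> d0 d1; rewrite -[2]/(1 + 1).
apply: reach_trans.
  by apply: (turn_left (s' := p1) (w := head None (map Some v))); case: v d0.
apply: (@reach_trans _ 1 0); first by apply: turn_right.
apply: reach_ceq; rewrite /layout.
by case: (rev (map Some u)) => [|y w]; case: v {d0} => [|x v]; apply: ceq_refl.
Qed.

Lemma reach_rewind body q k u v o :
  reach body (size u + 2) (layout (Rewind q, k, u, v, o))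
    (layout (q, k, [::], u ++ v, o)).
Proof.
rewrite addnC -[2]/(1 + 1) -addnA.
apply: reach_trans; first exact: turn_left.
rewrite -map_rev addnC -(size_rev u).
apply: reach_trans; first exact: scan_left.
apply: (@reach_trans _ 1 0); first exact: turn_right.
rewrite -map_rev revK /layout map_cat -catA.
by case: v => [|x v]; apply/reach_ceq/ceq_refl.
Qed.

Lemma reach_inc body q k v o :
  reach body (2 * k + 5) (layout (Inc q, k, [::], v, o))
    (layout (q, k.+1, [::], v, o)).
Proof.
apply: (@reach_le _ (1 + (1 + (size (nseq k true) + (0 + (1 + (size (nseq k true) + (1 + 0)))))))).
  by rewrite !size_nseq; lia.
apply: reach_trans; first exact: turn_left.
apply: reach_trans; first exact: step_left.
rewrite /= -/(ones k) -[ones k]cats0.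
apply: reach_trans; first exact: scan_left.
apply: reach_trans.
  by apply/reach_ceq/(ceq_left _ _ (fun=> erefl))/(teq_sym (teq_nil 1)).
apply: reach_trans; first exact: turn_right.
rewrite -/(ones k) rev_ones.
apply: reach_trans; first exact: scan_right.
apply: reach_trans; first exact: step_right.
rewrite -/(ones k) rev_ones ones_cons.
by case: v => [|x v]; apply/reach_ceq/ceq_refl.
Qed.

Lemma reach_dec body q k v o :
  reach body (2 * k + 7) (layout (Dec q, k.+1, [::], v, o))
    (layout (q, k, [::], v, o)).
Proof.
have -> : 2 * k + 7 = 1 + (1 + (2 * k + 5)) by lia.
apply: reach_trans; first exact: turn_left.
apply: reach_trans; first exact: step_left.
by case: v => [|x v]; apply: (@reach_erase _ _ _ _ k.+1 0); rewrite ?addn0 // => -[|[|i]].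
Qed.

Lemma reach_test body q0 q1 k v o :
  reach body 4 (layout (Test q0 q1, k, [::], v, o))
    (layout (if k is 0 then q0 else q1, k, [::], v, o)).
Proof.
rewrite -[4]/(1 + (1 + (1 + (1 + 0)))).
apply: reach_trans; first exact: turn_left.
apply: reach_trans; first exact: step_left.
apply: reach_trans; first exact: turn_right.
apply: reach_trans; first exact: step_right.
by case: k => [|k]; case: v => [|x v]; apply: reach_ceq; split=> //;
  move=> [|[|i]] //=; rewrite ?nth_nil.
Qed.

Definition hsize (c : hconf) : nat :=
  let '(_, k, u, v, o) := c in k + size u + size v + size o.

Lemma reach_hstep body c d : hstep body c = Some d ->
  reach body (2 * hsize c + 9) (layout c) (layout d).
Proof.
case: c => [[[[p k] u] v] o]; case: p => /=.
- by [].
- by [].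
- move=> b [<-]; apply: reach_le; last first.
    by apply: (@reach_nudge _ _ (Jump b, (1, false))).
  lia.
- move=> b q; case: v => // x v [<-] /=.
  by apply: reach_le; last exact: reach_emit; lia.
- move=> q; case: v => // x v [<-] /=.
  apply: reach_le; last (apply: reach_copy => //; by case=> [|[|[|[|[]]]]]); lia.
- move=> q; case: v => // x v [<-] /=.
  apply: reach_le; last (apply: reach_copy => //; by case=> [|[|[|[|[]]]]]); lia.
- by move=> q [<-]; apply: reach_le; last exact: reach_rewind; lia.
- move=> q; case: u => //; case: v => // x v [<-] /=.
  by apply: reach_le; last exact: (reach_pop (q := fun x => if x then DropBit q else q)); lia.
- move=> q; case: u => //; case: v => // x v [<-] /=.
  by apply: reach_le; last exact: (reach_pop (q := fun=> Drop q)); lia.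
- move=> q0 q1; case: u => //; case: v => // x v [<-] /=.
  by apply: reach_le; last exact: (reach_pop (q := fun x => if x then q1 else q0)); lia.
- by move=> q; case: u => // [[<-]]; apply: reach_le; last exact: reach_inc; lia.
- move=> q; case: u => //; case: k => // k [<-].
  by apply: reach_le; last exact: reach_dec; rewrite /=; lia.
- by move=> q0 q1; case: u => // [[<-]]; apply: reach_le; last exact: reach_test; lia.
- move=> q0 q1 [<-]; apply: reach_le; last first.
    apply: (@reach_nudge _ _ (IfEnd q0 q1, (1, v != [::]))); first by case: v.
    by move=> h; case: v.
  lia.
Qed.

(** The result is read from the head rightwards, so the head has to leave the separator for the
    first cell of the output. *)
Lemma reach_fin body k o :
  reach body 1 (layout (Fin, k, [::], [::], o))
    (at_right (Halt, (0, false)) (None :: None :: ones k) (map Some o)).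
Proof. exact: step_right. Qed.

Fixpoint hrun (body : bool -> prog) (n : nat) (c : hconf) : option hconf :=
  if n is n'.+1 then obind (hrun body n') (hstep body c) else Some c.

Lemma hsize_hstep body c d : hstep body c = Some d -> hsize d <= (hsize c).+1.
Proof.
case: c => [[[[p k] u] v] o].
by case: p => [||b|b q|q|q|q|q|q|q0 q1|q|q|q0 q1|q0 q1] /=;
  case: u => [|y u]; case: v => [|x v]; case: k => [|k] //= [<-] //=;
  rewrite ?size_cat ?size_rcons /=; lia.
Qed.

(** An instruction costs linear time in the tape contents, which grow by at most one cell per
    instruction. *)
Lemma reach_hrun body n c d : hrun body n c = Some d ->
  reach body (n * (2 * (hsize c + n) + 9)) (layout c) (layout d).
Proof.
elim: n c => [|n IH] c /= => [[<-]|]; first exact/reach_ceq/ceq_refl.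
case E: (hstep body c) => [c'|] //= /IH.
have := hsize_hstep E; move/reach_hstep: E => h1 sz h2.
by apply: reach_le (reach_trans h1 h2); nia.
Qed.

(** * Finiteness of the set of states, and the machine *)

Definition targets (body : bool -> prog) (p : prog) : seq prog :=
  match p with
  | Halt => [::]
  | Fin => [:: Halt]
  | Jump b => [:: body b]
  | Emit _ q | Rewind q | Inc q | Dec q => [:: q]
  | Copy q => [:: q; CopyBit q]
  | CopyBit q => [:: Copy q]
  | Drop q => [:: q; DropBit q]
  | DropBit q => [:: Drop q]
  | Pop q0 q1 | Test q0 q1 | IfEnd q0 q1 => [:: q0; q1]
  end.

(** Closed under control flow except for jumps and halting: [Copy] and [CopyBit], like [Drop] and
    [DropBit], lead to each other and are listed together. *)
Fixpoint subprogs (p : prog) : seq prog :=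
  match p with
  | Halt | Fin | Jump _ => [:: p]
  | Emit _ q | Rewind q | Inc q | Dec q => p :: subprogs q
  | Copy q => [:: p, CopyBit q & subprogs q]
  | CopyBit q => [:: p, Copy q & subprogs q]
  | Drop q => [:: p, DropBit q & subprogs q]
  | DropBit q => [:: p, Drop q & subprogs q]
  | Pop q0 q1 | Test q0 q1 | IfEnd q0 q1 => p :: subprogs q0 ++ subprogs q1
  end.

Definition progs (body : bool -> prog) (start : prog) : seq prog :=
  subprogs start ++ subprogs (body false) ++ subprogs (body true) ++ [:: Halt].

Lemma subprogs_refl p : p \in subprogs p.
Proof. by case: p => *; rewrite /= inE eqxx. Qed.

Definition targets_in (body : bool -> prog) (s t : seq prog) : bool :=
  all (fun q => all (fun r => r \in t) (targets body q)) s.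

Lemma targets_in_sub body s t t' : {subset t <= t'} ->
  targets_in body s t -> targets_in body s t'.
Proof. by move=> tt'; apply: sub_all => q; apply: sub_all => r /tt'. Qed.

Lemma subprogs_targets body p :
  targets_in body (subprogs p) (subprogs p ++ [:: body false; body true; Halt]).
Proof.
set roots := [:: _; _; _].
have rH : Halt \in roots by rewrite !inE eqxx !orbT.
have rb b : body b \in roots by case: b; rewrite !inE eqxx ?orbT.
move: roots rH rb => roots rH rb.
have sub1 q t : targets_in body (subprogs q) (subprogs q ++ roots) ->
    {subset subprogs q <= t} -> {subset roots <= t} -> targets_in body (subprogs q) t.
  by move=> h qt rt; apply: targets_in_sub h => r; rewrite mem_cat => /orP[/qt|/rt].
elim: p => [||b|b p IH|p IH|p IH|p IH|p IH|p IH|p0 IH0 p1 IH1|p IH|p IH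
  |p0 IH0 p1 IH1|p0 IH0 p1 IH1];
  rewrite /targets_in /= ?all_cat -?/(targets_in _ _ _) ?inE ?mem_cat ?subprogs_refl
    ?eqxx ?rH ?rb ?orbT //=.
all: try (by apply: sub1 => // r rp; rewrite ?inE ?mem_cat rp ?orbT).
all: by apply/andP; split; apply: sub1 => // r rp; rewrite ?inE ?mem_cat rp ?orbT.
Qed.

Lemma progs_targets body start :
  targets_in body (progs body start) (progs body start).
Proof.
have roots : {subset [:: body false; body true; Halt] <= progs body start}.
  move=> r; rewrite /progs !inE !mem_cat inE => /or3P[] /eqP->;
  by rewrite ?subprogs_refl ?eqxx ?orbT.
have sub p : {subset subprogs p <= progs body start} ->
    targets_in body (subprogs p) (progs body start).
  move=> h; apply: targets_in_sub (subprogs_targets body p) => r.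
  by rewrite mem_cat => /orP[/h|/roots].
rewrite {1}/progs /targets_in !all_cat -!/(targets_in _ _ _) /= andbT.
by rewrite !sub // => r rp; rewrite /progs !mem_cat rp ?orbT.
Qed.

Lemma delta_targets body p i c h p' i' c' w d :
  delta body (p, (i, c)) h = Some ((p', (i', c')), w, d) ->
  ((p' == p) || (p' \in targets body p)) && (i' < 6).
Proof.
case: p => [||b|b q|q|q|q|q|q|q0 q1|q|q|q0 q1|q0 q1] /=.
all: case: i => [|[|[|[|[|[|i]]]]]] /=; case: h => [x|] //= [];
  repeat (move=> <- || move=> <- _ || idtac) => //=.
all: try by move=> *; subst; rewrite !inE !eqxx ?orbT.
all: by try case: c; move=> *; subst; rewrite !inE !eqxx ?orbT.
Qed.

Definition phases : seq (nat * bool) := [seq (i, c) | i <- iota 0 6, c <- [:: false; true]].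

Lemma mem_phases i c : ((i, c) \in phases) = (i < 6).
Proof. by case: c; do 6 (case: i => [|i] //). Qed.

Definition states (body : bool -> prog) (start : prog) : seq state :=
  [seq (p, m) | p <- progs body start, m <- phases].

Lemma mem_states body start p i c :
  ((p, (i, c)) \in states body start) = (p \in progs body start) && (i < 6).
Proof.
rewrite -(mem_phases i c); apply/allpairsP/andP => [[[q m] [qp mm [-> ->]]]|[pp i6]] //.
by exists (p, (i, c)).
Qed.

Lemma delta_states body start s h s' w d : s \in states body start ->
  delta body s h = Some (s', w, d) -> s' \in states body start.
Proof.
case: s s' => p [i c] [p' [i' c']]; rewrite !mem_states => /andP[pp _].
move=> /delta_targets/andP[/orP[/eqP->|p't] ->]; rewrite andbT //.
by move: (progs_targets body start) => /allP/(_ p pp)/allP/(_ _ p't).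
Qed.

(** The successor gives [inord] its nonempty range; the surplus index decodes to the halting
    default. *)
Definition state_index (body : bool -> prog) (start : prog) (s : state) :
    'I_(size (states body start)).+1 := inord (index s (states body start)).

Definition state_of (body : bool -> prog) (start : prog)
    (q : 'I_(size (states body start)).+1) : state :=
  nth (Halt, (0, false)) (states body start) q.

Lemma state_indexK body start s : s \in states body start ->
  state_of (state_index body start s) = s.
Proof.
by move=> ss; rewrite /state_of inordK ?nth_index // ltnS index_size.
Qed.

Definition machine (body : bool -> prog) (start : prog) : TM :=
  {| tm_nstates := (size (states body start)).+1;
     tm_start := state_index body start (start, (0, false));
     tm_delta := fun q h =>
       if delta body (state_of q) h is Some (s, w, d)
       then Some (state_index body start s, w, d) else None |}.

Definition embed (body : bool -> prog) (start : prog) (c : sconf) :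
    config (machine body start) :=
  let '(s, L, h, R) := c in (state_index body start s, L, h, R).

Lemma tm_run_embed body start n s L h R : s \in states body start ->
  let c := srun body n (s, L, h, R) in
  tm_run n (embed body start (s, L, h, R)) = embed body start c /\
  c.1.1.1 \in states body start.
Proof.
elim: n s L h R => [|n IH] s L h R ss //=.
rewrite state_indexK //; case E: (delta body s h) => [[[s' w] d]|] //=.
by have := delta_states ss E; case: d {E} => s's; apply: IH.
Qed.

Lemma read_bits_teq s t : teq s t -> read_bits s = read_bits t.
Proof.
elim: s t => [|x s IH] [|y t] h //.
- by have /= := h 0; case: y {h}.
- by have /= := h 0; case: x {h}.
have /= xy := h 0; rewrite -{}xy; case: x h => //= b h.
by rewrite (IH t) // => i; apply: (h i.+1).
Qed.

Lemma read_bits_map v : read_bits (map Some v) = v.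
Proof. by elim: v => //= b v ->. Qed.

Lemma machine_computes body start n k w v :
  hrun body n (start, 0, [::], w, [::]) = Some (Fin, k, [::], [::], v) ->
  tm_computes_within (machine body start) w v (n * (2 * (size w + n) + 9) + 1).
Proof.
move=> /reach_hrun; rewrite [hsize _]/= addn0 add0n => hr.
have := reach_trans hr (reach_fin body k v).
set c0 := layout _; pose c1 : sconf :=
  ((start, (0, false)), [::], head None (map Some w), map Some (behead w)).
(* The separators on both sides of the input are implicit in the initial tape. *)
have e1 : ceq c1 c0.
  split=> //; first exact: (teq_sym (teq_nil 1)).
  - by case: (w).
  - case: (w) => [|x w'] /=; first by move=> i.
    by rewrite -[X in teq X _]cats0; apply/teq_cat/(teq_sym (teq_nil 1)).
move=> [m mle hm]; exists m; split=> //.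
have ss : (start, (0, false)) \in states body start.
  by rewrite mem_states /progs mem_cat subprogs_refl.
have [run fin] := tm_run_embed m [::] (head None (map Some w)) (map Some (behead w)) ss.
have /= := ceq_trans (srun_ceq body m e1) hm.
rewrite -[tm_init _ _]/(embed body start c1) {}run -/c1.
move: fin; case: (srun body m c1) => [[[s L] h] R] /= ss' [sE _ hE hR]; split.
  by rewrite state_indexK // sE.
rewrite -[LHS]/(read_bits (h :: R)) -[RHS]read_bits_map; subst h.
rewrite (read_bits_teq (t := head None (map Some v) :: behead (map Some v))).
  by case: v {hm hr hR}.
exact: teq_cons.
Qed.

(** * Closing a formula by quantifying all its numbers *)

Fixpoint term_numbers (t : ph_term) : seq nat :=
  match t with
  | PT_const a => [:: 0; a]
  | PT_mul a x => [:: 1; a; x]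
  | PT_add t1 t2 => 2 :: term_numbers t1 ++ term_numbers t2
  end.

Fixpoint form_numbers (f : ph_form) : seq nat :=
  match f with
  | PH_le t1 t2 => 0 :: term_numbers t1 ++ term_numbers t2
  | PH_not g => 1 :: form_numbers g
  | PH_and g h => 2 :: form_numbers g ++ form_numbers h
  | PH_ex x g => [:: 3, x & form_numbers g]
  | PH_hartig x y g => [:: 4, x, y & form_numbers g]
  end.

Lemma enc_ph_term_numbers t : enc_ph_term t = flatten (map enc_nat (term_numbers t)).
Proof.
elim: t => [a|a x|t1 IH1 t2 IH2] /=; rewrite ?cats0 //.
by rewrite map_cat flatten_cat IH1 IH2.
Qed.

Lemma enc_ph_numbers f : enc_ph f = flatten (map enc_nat (form_numbers f)).
Proof.
by elim: f => [t1 t2|g IH|g IHg h IHh|x g IH|x y g IH];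
   rewrite [LHS]/= ?IH ?IHg ?IHh ?enc_ph_term_numbers -?flatten_cat -?map_cat.
Qed.

Lemma ph_eval_agree t eta eta' :
  {in term_numbers t, eta =1 eta'} -> ph_eval eta t = ph_eval eta' t.
Proof.
elim: t => [a|a x|t1 IH1 t2 IH2] //= h.
  by rewrite h // !inE eqxx !orbT.
by rewrite IH1 ?IH2 // => x xt; apply: h; rewrite inE mem_cat xt !orbT.
Qed.

(** Tags and coefficients are listed as well, so [form_numbers] over-approximates the free
    variables. *)
Lemma ph_holds_agree f eta eta' :
  {in form_numbers f, eta =1 eta'} -> (ph_holds eta f <-> ph_holds eta' f).
Proof.
have upd_agree (s : seq nat) x b e1 e2 : {in s, e1 =1 e2} -> {in s, upd e1 x b =1 upd e2 x b}.
  by move=> h z zs; rewrite /upd h.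
elim: f eta eta' => [t1 t2|g IH|g IHg h IHh|x g IH|x y g IH] eta eta' E.
- have E1 : ph_eval eta t1 = ph_eval eta' t1.
    by apply: ph_eval_agree => z zt; apply: E; rewrite /= inE mem_cat zt !orbT.
  have E2 : ph_eval eta t2 = ph_eval eta' t2.
    by apply: ph_eval_agree => z zt; apply: E; rewrite /= inE mem_cat zt !orbT.
  by rewrite /= E1 E2.
- have Eg : {in form_numbers g, eta =1 eta'}.
    by move=> z zg; apply: E; rewrite /= inE zg orbT.
  by have := IH _ _ Eg => /=; tauto.
- have Eg : {in form_numbers g, eta =1 eta'}.
    by move=> z zg; apply: E; rewrite /= inE mem_cat zg !orbT.
  have Eh : {in form_numbers h, eta =1 eta'}.
    by move=> z zg; apply: E; rewrite /= inE mem_cat zg !orbT.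
  by have := IHg _ _ Eg; have := IHh _ _ Eh => /=; tauto.
- have Eg : {in form_numbers g, eta =1 eta'}.
    by move=> z zg; apply: E; rewrite /= !inE zg !orbT.
  have H b := IH _ _ (upd_agree _ x b _ _ Eg).
  by split=> [[b /H]|[b /H]]; exists b.
- have Eg : {in form_numbers g, eta =1 eta'}.
    by move=> z zg; apply: E; rewrite /= !inE zg !orbT.
  have Ex : eta x = eta' x by apply: E; rewrite /= !inE eqxx orbT.
  have H b := IH _ _ (upd_agree _ y b _ _ Eg).
  split=> [[s [us [h sz]]]|[s [us [h sz]]]]; exists s; rewrite sz Ex; do 2 split=> //.
    by move=> b; apply: iff_trans (h b) (H b).
  by move=> b; apply: iff_trans (h b) (iff_sym (H b)).
Qed.

Definition c_close (e : bool) (l : seq nat) (c : cform) : cform :=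
  foldr (fun n g => c_ex e vpos (C_bind (var n) g)) c l.

(* All numbers occurring in [f] are quantified, since an encoded variable cannot be
   told from an encoded coefficient without parsing. *)
Definition tr_top (e : bool) (f : ph_form) : cform :=
  c_close e (form_numbers f)
    (c_ex e vval (C_and (c_qf e (ph_nonzero vval)) (tr_form e f))).

Lemma expresses_close e l c R : expresses c (fun th => R (env th)) ->
  expresses (c_close e l c) (fun th =>
    exists2 eta, (forall x, x \notin l -> eta x = env th x) & R eta).
Proof.
move=> hc; elim: l => [|n l IH] /=.
  apply: eq_expresses hc _ => th _; split=> [h|[eta h]]; first by exists (env th).
  by rewrite (_ : eta = env th) //; apply: functional_extensionality => x; apply: h.
apply: eq_expresses.
  by apply: expresses_ex => //; apply: expresses_bind IH.
move=> th _; split=> [[j [eta h Re]]|[eta h Re]].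
  exists eta => // x; rewrite inE negb_or => /andP[xn xl].
  by rewrite h // env_upd_var upd_same env_upd_aux // /upd (negbTE xn).
exists (eta n), eta => // x xl; rewrite upd_same env_upd_var env_upd_aux // /upd.
by case: eqP => [->//|/eqP xn]; apply: h; rewrite inE negb_or xn.
Qed.

Lemma models_tr_top e f : models loop_ks (tr_top e f) <-> ph_satisfiable f.
Proof.
have hc : expresses (c_ex e vval (C_and (c_qf e (ph_nonzero vval)) (tr_form e f)))
    (fun th => ph_holds (env th) f).
  apply: eq_expresses.
    apply: expresses_ex => //; apply: expresses_here.
    by apply: expresses_and; [apply: expresses_qf | apply: tr_form_correct].
  move=> th _; split=> [[j [/ph_holds_nonzero]]|h].
    by rewrite upd_same env_upd_aux //; tauto.
  by exists 1; split; [apply/ph_holds_nonzero | rewrite upd_same env_upd_aux].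
have hm := expresses_close e (form_numbers f) (R := fun eta => ph_holds eta f) hc.
split=> [[rho [i [_ [_]]]]|[eta h]].
  by rewrite (loop_runE rho) => /(hm i (fun=> 0) erefl)[eta _ h]; exists eta.
exists loop_run, 0; split; first exact: loop_runP.
split; first exact: loop_state.
apply/(hm 0 (fun=> 0) erefl).
(* Model checking starts from the zero valuation, so the witness has to vanish off the quantified
   numbers. *)
exists (fun x => if x \in form_numbers f then eta x else 0).
  by move=> x /negbTE->.
by apply: (proj2 (@ph_holds_agree f _ eta _)) h => x ->.
Qed.

(** * Membership in the fragments *)

Definition frag (e : bool) : cform -> bool := if e then is_cctl else is_cltl.

Lemma frag_ex e v c : frag e (c_ex e v c) = frag e c.
Proof. by case: e. Qed.

Lemma frag_all e v c : frag e (c_all e v c) = frag e c.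
Proof. by case: e. Qed.

Lemma frag_FG e c : frag e (c_FG e c) = frag e c.
Proof. by case: e. Qed.

Lemma frag_and e c d : frag e (C_and c d) = frag e c && frag e d.
Proof. by case: e. Qed.

Lemma frag_not e c : frag e (C_not c) = frag e c.
Proof. by case: e. Qed.

Lemma frag_bind e v c : frag e (C_bind v c) = frag e c.
Proof. by case: e. Qed.

Lemma frag_leq e t1 t2 : frag e (c_leq e (c_term t1) (c_term t2)).
Proof.
have ht t : is_cctl_t (c_term t) && is_cltl_t (c_term t).
  by elim: t => //= t1' /andP[-> ->] t2' /andP[-> ->].
rewrite /c_leq frag_FG; have /andP[h1 h1'] := ht t1; have /andP[h2 h2'] := ht t2.
by case: e; rewrite /= ?h1 ?h1' ?h2 ?h2'.
Qed.

Lemma frag_qf e f : frag e (c_qf e f).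
Proof.
by elim: f => [t1 t2|g IH|g IHg h IHh|//|//]; rewrite ?frag_leq // ?frag_not // frag_and IHg.
Qed.

Lemma frag_count_ge e y c : frag e (c_count_ge e y c) = frag e c.
Proof. by rewrite /c_count_ge frag_FG; case: e. Qed.

Lemma frag_tr_term e t : frag e (tr_term e t).
Proof.
elim: t => [a|a x|t1 IH1 t2 IH2]; first exact: frag_qf.
  by rewrite /tr_term frag_ex frag_and !frag_qf.
rewrite /tr_term -/tr_term /c_binary /c_rebind.
by rewrite !(frag_ex, frag_and, frag_qf) IH1 IH2.
Qed.

Lemma frag_tr_form e f : frag e (tr_form e f).
Proof.
elim: f => [t1 t2|g IH|g IHg h IHh|x g IH|x y g IH];
  rewrite /tr_form -?/tr_form -?/(tr_form _ _) /c_binary /c_switch /c_rebind;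
  by rewrite !(frag_all, frag_ex, frag_and, frag_qf, frag_not, frag_bind,
    frag_count_ge, frag_tr_term) ?IH ?IHg ?IHh.
Qed.

Lemma frag_tr_top e f : frag e (tr_top e f).
Proof.
rewrite /tr_top; elim: (form_numbers f) => [|n l IH]; rewrite /c_close /foldr.
  by rewrite !(frag_ex, frag_and, frag_qf) frag_tr_form.
by rewrite frag_ex frag_bind.
Qed.

(** * Computing the translation *)

Definition enc_bits (s : seq bool) : seq bool :=
  flatten [seq [:: true; b] | b <- s] ++ [:: false].

Lemma bin_aux_fuel k n : n <= k -> bin_aux k n = bin_aux n n.
Proof.
elim/ltn_ind: n k => n IH [|k] nk; first by move: nk; rewrite leqn0 => /eqP->.
case: n IH nk => //= n IH nk; congr (_ :: _).
by rewrite !(IH (uphalf n)) //; lia.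
Qed.

(** With the least significant digit first, 2x + 1 is x with a digit 1 put in front. Thus renaming a
    variable amounts to emitting two fixed bits before copying its code. *)
Lemma enc_nat_var x : enc_nat (var x) = [:: true; true] ++ enc_nat x.
Proof.
rewrite /enc_nat /var /= odd_double /= uphalf_double bin_aux_fuel //.
by rewrite -addnn leq_addr.
Qed.

Lemma enc_C_and c d : enc_cform (C_and c d) = enc_nat 1 ++ enc_cform c ++ enc_cform d.
Proof. by []. Qed.

Lemma enc_C_not c : enc_cform (C_not c) = enc_nat 2 ++ enc_cform c.
Proof. by []. Qed.

Lemma enc_C_bind v c : enc_cform (C_bind v c) = enc_nat 6 ++ enc_nat v ++ enc_cform c.
Proof. by []. Qed.

Lemma enc_C_le t1 t2 : enc_cform (C_le t1 t2) = enc_nat 7 ++ enc_cterm t1 ++ enc_cterm t2.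
Proof. by []. Qed.

Lemma enc_CT_count a x c : enc_cterm (CT_count a x c) =
  enc_nat 1 ++ enc_int a ++ enc_nat x ++ enc_cform c.
Proof. by []. Qed.

Lemma enc_CT_const a : enc_cterm (CT_const a) = enc_nat 0 ++ enc_int a.
Proof. by []. Qed.

Lemma enc_Posz n : enc_int (Posz n) = [:: false] ++ enc_nat n.
Proof. by []. Qed.

Lemma enc_c_until e c d : enc_cform (c_until e c d) =
  (if e then enc_nat 5 else [::]) ++ enc_nat 4 ++ enc_cform c ++ enc_cform d.
Proof. by case: e. Qed.

Lemma enc_nat0 : enc_nat 0 = [:: false]. Proof. by []. Qed.
Lemma enc_nat1 : enc_nat 1 = [:: true; true; false]. Proof. by []. Qed.
Lemma enc_nat2 : enc_nat 2 = [:: true; false; true; true; false]. Proof. by []. Qed.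
Lemma enc_nat3 : enc_nat 3 = [:: true; true; true; true; false]. Proof. by []. Qed.
Lemma enc_nat4 : enc_nat 4 = [:: true; false; true; false; true; true; false].
Proof. by []. Qed.

Lemma enc_natE n : enc_nat n = enc_bits (bin_aux n n).
Proof. by []. Qed.

(* Rewriting with [catA] would unfold the encodings to lists of bits if they were
   not generalized. *)
Ltac cat_reassoc :=
  repeat match goal with
  | |- context [cat ?a ?b] =>
      lazymatch a with
      | cat _ _ => fail
      | _ => tryif is_var a then fail else (generalize a; intro)
      end
  | |- context [cat ?a ?b] =>
      lazymatch b with
      | cat _ _ => fail
      | _ => tryif is_var b then fail else (generalize b; intro)
      end
  end;
  rewrite -?catA; reflexivity.

Opaque enc_nat enc_int enc_cform enc_cterm.

Definition s_F (e : bool) : seq bool :=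
  (if e then enc_nat 5 else [::]) ++ enc_nat 4 ++ enc_cform c_top.

Definition s_FG (e : bool) : seq bool := s_F e ++ enc_nat 2 ++ s_F e ++ enc_nat 2.

Definition s_leq (e : bool) : seq bool := s_FG e ++ enc_nat 7.

Definition s_ex (e : bool) : seq bool :=
  s_F e ++ enc_nat 7 ++ enc_cterm (CT_const (Posz 1)) ++ enc_nat 1 ++
  enc_int (Posz 1) ++ enc_nat 0 ++ enc_nat 6.

Definition s_below1 : seq bool := enc_nat 7 ++ enc_nat 1 ++ enc_int (Posz 1).
Definition s_below2 : seq bool := enc_cform c_top ++ enc_cterm (CT_const (Posz 0)).

Definition s_val1 : seq bool :=
  enc_nat 1 ++ enc_int (Posz 1) ++ enc_nat 0 ++ s_below1.

Definition s_switch (e b : bool) (v : nat) : seq bool :=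
  enc_nat 2 ++ s_ex e ++ enc_nat vuni ++ enc_nat 2 ++ s_ex e ++ enc_nat v ++ enc_nat 1 ++
  enc_cform (c_qf e (ph_imp (if b then ph_zero vval else ph_nonzero vval)
                            (ph_eq (pvar v) (pvar vuni)))).

Definition s_rebind (e : bool) (b : nat) : seq bool :=
  s_ex e ++ enc_nat vval ++ enc_nat 1 ++ enc_cform (c_qf e (ph_eq (pvar vval) (pvar b))).

Definition s_binary (e : bool) (q : ph_form) : seq bool :=
  s_ex e ++ enc_nat vfst ++ s_ex e ++ enc_nat vsnd ++ enc_nat 1 ++
  enc_cform (c_qf e q) ++ enc_nat 1 ++ s_rebind e vfst.

Lemma enc_c_F e c : enc_cform (c_F e c) = s_F e ++ enc_cform c.
Proof. by rewrite /c_F enc_c_until /s_F; cat_reassoc. Qed.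

Lemma enc_c_FG e c : enc_cform (c_FG e c) = s_FG e ++ enc_cform c.
Proof.
by rewrite /c_FG enc_c_F enc_C_not enc_c_F enc_C_not /s_FG; cat_reassoc.
Qed.

Lemma enc_c_ex e v c : enc_cform (c_ex e v c) = s_ex e ++ enc_nat v ++ enc_cform c.
Proof. by rewrite /c_ex enc_c_F enc_C_le enc_CT_count enc_C_bind /s_ex; cat_reassoc. Qed.

Lemma enc_c_below v : enc_cform (c_below v) = s_below1 ++ enc_nat v ++ s_below2.
Proof.
by rewrite /c_below enc_C_le enc_CT_count /s_below1 /s_below2; cat_reassoc.
Qed.

Lemma enc_pvar v : enc_cterm (c_term (pvar v)) = s_val1 ++ enc_nat v ++ s_below2.
Proof.
by rewrite -[c_term _]/(CT_count (Posz 1) 0 (c_below v)) enc_CT_count enc_c_below /s_val1; cat_reassoc.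
Qed.

Lemma enc_FG_le e t1 t2 : enc_cform (c_FG e (C_le t1 t2)) =
  s_leq e ++ enc_cterm t1 ++ enc_cterm t2.
Proof. by rewrite enc_c_FG enc_C_le /s_leq; cat_reassoc. Qed.

Opaque s_F s_FG s_leq s_ex s_below1 s_below2 s_val1.

Lemma enc_ph_eq e t1 t2 : enc_cform (c_qf e (ph_eq t1 t2)) =
  enc_nat 1 ++ s_leq e ++ enc_cterm (c_term t1) ++ enc_cterm (c_term t2) ++
  s_leq e ++ enc_cterm (c_term t2) ++ enc_cterm (c_term t1).
Proof.
rewrite /c_qf /ph_eq -/(c_qf e) enc_C_and /c_leq !enc_FG_le.
cat_reassoc.
Qed.

Lemma enc_c_rebind e b c :
  enc_cform (c_rebind e b c) = s_rebind e b ++ enc_cform c.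
Proof. by rewrite /c_rebind enc_c_ex enc_C_and /s_rebind; cat_reassoc. Qed.

Lemma enc_c_binary e q c d : enc_cform (c_binary e q c d) =
  s_binary e q ++ enc_cform c ++ s_rebind e vsnd ++ enc_cform d.
Proof.
by rewrite /c_binary !enc_c_ex !enc_C_and !enc_c_rebind /s_binary; cat_reassoc.
Qed.

Lemma enc_c_switch e b v c :
  enc_cform (c_switch e b v c) = s_switch e b v ++ enc_cform c.
Proof.
rewrite /c_switch /c_all.
by rewrite enc_C_not enc_c_ex enc_C_not enc_c_ex enc_C_and /s_switch; cat_reassoc.
Qed.

Opaque s_switch s_rebind s_binary.

(** An equation is a pair of opposite inequalities, which is why a number compared by one appears
    twice. *)
Definition s_const1 e := enc_nat 1 ++ s_leq e ++ enc_cterm (c_term (pvar vval)) ++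
  enc_nat 0 ++ [:: false].
Definition s_const2 e := s_leq e ++ enc_nat 0 ++ [:: false].
Definition s_const3 := enc_cterm (c_term (pvar vval)).

Lemma enc_tr_const e a : enc_cform (tr_term e (PT_const a)) =
  s_const1 e ++ enc_nat a ++ s_const2 e ++ enc_nat a ++ s_const3.
Proof.
rewrite /tr_term enc_ph_eq.
rewrite -[c_term (PT_const a)]/(CT_const (Posz a)) enc_CT_const enc_Posz.
by rewrite /s_const1 /s_const2 /s_const3; cat_reassoc.
Qed.

Definition s_mul1 e := s_ex e ++ enc_nat vpos ++ enc_nat 1 ++ enc_nat 1 ++ s_leq e ++
  enc_cterm (c_term (pvar vval)) ++ enc_nat 1 ++ [:: false].
Definition s_mul2 e := enc_nat 0 ++ enc_cform (c_below vpos) ++ s_leq e ++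
  enc_nat 1 ++ [:: false].
Definition s_mul3 e := enc_nat 0 ++ enc_cform (c_below vpos) ++
  enc_cterm (c_term (pvar vval)) ++ enc_nat 1 ++ s_leq e ++
  enc_cterm (c_term (pvar vpos)) ++ s_val1 ++ [:: true; true].
Definition s_mul4 e := s_below2 ++ s_leq e ++ s_val1 ++ [:: true; true].
Definition s_mul5 := s_below2 ++ enc_cterm (c_term (pvar vpos)).

Lemma enc_tr_mul e a x : enc_cform (tr_term e (PT_mul a x)) =
  s_mul1 e ++ enc_nat a ++ s_mul2 e ++ enc_nat a ++
  s_mul3 e ++ enc_nat x ++ s_mul4 e ++ enc_nat x ++ s_mul5.
Proof.
rewrite /tr_term enc_c_ex enc_C_and !enc_ph_eq (enc_pvar (var x)) enc_nat_var.
rewrite -[c_term (PT_mul _ _)]/(CT_count (Posz a) 0 (c_below vpos)) enc_CT_count enc_Posz.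
by rewrite /s_mul1 /s_mul2 /s_mul3 /s_mul4 /s_mul5; cat_reassoc.
Qed.

Definition s_exists e := s_switch e true vpos ++ enc_nat 6 ++ [:: true; true].

Lemma enc_tr_ex e x g : enc_cform (tr_form e (PH_ex x g)) =
  s_exists e ++ enc_nat x ++ enc_cform (tr_form e g).
Proof.
rewrite /tr_form -/(tr_form e g) enc_c_switch enc_C_bind enc_nat_var.
by rewrite /s_exists; cat_reassoc.
Qed.

Definition s_hartig1 e := s_ex e ++ enc_nat vcard ++ enc_nat 1 ++ enc_nat 1 ++ s_leq e ++
  enc_cterm (c_term (pvar vcard)) ++ s_val1 ++ [:: true; true].
Definition s_hartig2 e := s_below2 ++ s_leq e ++ s_val1 ++ [:: true; true].
Definition s_hartig3 e := s_below2 ++ enc_cterm (c_term (pvar vcard)) ++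
  s_switch e true vstart ++ s_switch e false vbit ++ s_switch e false vend ++
  s_ex e ++ enc_nat vthr ++ enc_nat 1 ++ enc_cform (c_qf e rel_hartig) ++
  s_leq e ++ enc_cterm (c_term (pvar vthr)) ++ enc_nat 1 ++ enc_int (Posz 1) ++
  enc_nat 0 ++ enc_nat 6 ++ [:: true; true].
Definition s_hartig4 e := enc_nat 1 ++
  enc_cform (C_le (CT_count (Posz 1) vend c_top) (CT_const (Posz 1))) ++ s_rebind e vbit.

Lemma enc_c_count_ge e y c : enc_cform (c_count_ge e y c) =
  s_leq e ++ enc_cterm (c_term (pvar vthr)) ++ enc_nat 1 ++ enc_int (Posz 1) ++
  enc_nat 0 ++ enc_nat 6 ++ enc_nat (var y) ++ enc_nat 1 ++
  enc_cform (C_le (CT_count (Posz 1) vend c_top) (CT_const (Posz 1))) ++ enc_cform c.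
Proof.
by rewrite /c_count_ge enc_FG_le enc_CT_count enc_C_bind enc_C_and.
Qed.

Lemma enc_tr_hartig e x y g : enc_cform (tr_form e (PH_hartig x y g)) =
  s_hartig1 e ++ enc_nat x ++ s_hartig2 e ++ enc_nat x ++ s_hartig3 e ++ enc_nat y ++
  s_hartig4 e ++ enc_cform (tr_form e g).
Proof.
rewrite /tr_form -/(tr_form e g) enc_c_ex enc_C_and !enc_c_switch enc_c_ex enc_C_and.
rewrite enc_ph_eq (enc_pvar (var x)) enc_c_count_ge enc_c_rebind !enc_nat_var.
unfold s_hartig1, s_hartig2, s_hartig3, s_hartig4; cat_reassoc.
Qed.

Definition s_bind e := s_ex e ++ enc_nat vpos ++ enc_nat 6 ++ [:: true; true].
Definition s_top e := s_ex e ++ enc_nat vval ++ enc_nat 1 ++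
  enc_cform (c_qf e (ph_nonzero vval)).

Lemma enc_tr_top e f : enc_cform (tr_top e f) =
  flatten [seq s_bind e ++ enc_nat n | n <- form_numbers f] ++
  s_top e ++ enc_cform (tr_form e f).
Proof.
rewrite /tr_top; elim: (form_numbers f) => [|n l IH]; rewrite /c_close /foldr.
  by rewrite enc_c_ex enc_C_and -[flatten _]/[::] cat0s /s_top; cat_reassoc.
rewrite -[X in _ = X ++ _]/((s_bind e ++ enc_nat n) ++ flatten [seq s_bind e ++ enc_nat m | m <- l]).
rewrite -/(foldr _ _ _) -/(c_close _ _ _) enc_c_ex enc_C_bind.
by rewrite IH enc_nat_var /s_bind; cat_reassoc.
Qed.

(** * The translating program *)

Definition emits (s : seq bool) (q : prog) : prog := foldr Emit q s.

(* Whatever follows a leaf is the second child of a binary node. *)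
Definition p_after (e : bool) : prog := IfEnd Fin (emits (s_rebind e vsnd) (Jump true)).

(** Copying only passes over a number, [Rewind] returns to it for the second copy, and [Drop]
    consumes it. The final [Dec] records a completed term. *)
Definition p_const (e : bool) : prog :=
  emits (s_const1 e) (Copy (Rewind (emits (s_const2 e) (Copy (Rewind
  (emits s_const3 (Drop (Dec (p_after e))))))))).

Definition p_mul (e : bool) : prog :=
  emits (s_mul1 e) (Copy (Rewind (emits (s_mul2 e) (Copy (Rewind (Drop
  (emits (s_mul3 e) (Copy (Rewind (emits (s_mul4 e) (Copy (Rewind
  (emits s_mul5 (Drop (Dec (p_after e)))))))))))))))).

Definition p_hartig (e : bool) : prog :=
  emits (s_hartig1 e) (Copy (Rewind (emits (s_hartig2 e) (Copy (Rewind (Drop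
  (emits (s_hartig3 e) (Copy (Rewind (emits (s_hartig4 e) (Drop (Jump true)))))))))))).

Definition p_binary (e : bool) (q : ph_form) : prog := emits (s_binary e q) (Jump true).

(* The branchings follow the bits of [enc_nat 0], [enc_nat 1], and so on; here [Fin] is
   only reached on invalid inputs. *)
Definition p_term (e : bool) : prog :=
  Pop (p_const e)
    (Pop (Pop Fin (Pop Fin (Pop (Inc (p_binary e rel_add)) Fin)))
         (Pop (p_mul e) Fin)).

Definition p_form (e : bool) : prog :=
  Pop (Inc (Inc (p_binary e rel_le)))
    (Pop (Pop Fin (Pop (Pop Fin (Pop Fin (Pop (p_hartig e) Fin)))
                       (Pop (p_binary e rel_and) Fin)))
         (Pop (emits (enc_nat 2) (Jump true))
              (Pop Fin (Pop (emits (s_exists e) (Copy (Rewind (Drop (Jump true))))) Fin)))).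

(* The counter is the number of terms still to be read before the next
   subformula: it tells whether a tag is that of a term or of a formula. *)
Definition p_body (e : bool) (b : bool) : prog :=
  if b then Test (p_form e) (p_term e)
  else IfEnd (Rewind (emits (s_top e) (Jump true)))
             (emits (s_bind e) (Copy (Jump false))).

(** The loop entered here copies all numbers into the quantifier prefix without parsing; at the end
    of the input it rewinds and hands over to the parsing loop. *)
Definition p_start : prog := emits (enc_ks loop_ks) (Jump false).

(** * Correctness and cost of the translating program *)

Definition hreach (e : bool) (n : nat) (c d : hconf) : Prop :=
  exists2 m, m <= n & hrun (p_body e) m c = Some d.

Lemma hrun_add body m n c d : hrun body m c = Some d ->
  hrun body (m + n) c = hrun body n d.
Proof.
elim: m c => [|m IH] c /= => [[->] //|].
by case: (hstep body c) => //= c'; apply: IH.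
Qed.

Lemma hreach_refl e c : hreach e 0 c c.
Proof. by exists 0. Qed.

Lemma hreach_output e p k u v o o' : o = o' ->
  hreach e 0 (p, k, u, v, o) (p, k, u, v, o').
Proof. by move=> ->; apply: hreach_refl. Qed.

Lemma hreach_trans e m n c d d' : hreach e m c d -> hreach e n d d' ->
  hreach e (m + n) c d'.
Proof.
move=> [i im ci] [j jn dj]; exists (i + j); first exact: leq_add.
by rewrite (hrun_add _ ci).
Qed.

Lemma hreach_le e m n c d : m <= n -> hreach e m c d -> hreach e n c d.
Proof. by move=> mn [i im ci]; exists i => //; apply: leq_trans mn. Qed.

Lemma hreach_run e m c d : hrun (p_body e) m c = Some d -> hreach e m c d.
Proof. by exists m. Qed.

(** Emitting blanks the cell under the head as a mark, which requires an input bit there. *)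
Lemma hreach_emits e s q k u v o : v <> [::] ->
  hreach e (size s) (emits s q, k, u, v, o) (q, k, u, v, o ++ s).
Proof.
case: v => // x v _; elim: s o => [|b s IH] o; first by rewrite cats0; apply: hreach_refl.
apply: (hreach_trans (m := 1)); first exact: hreach_run.
by rewrite -cat_rcons; apply: IH.
Qed.

Lemma hreach_copy e n q k u v o : hreach e (size (enc_nat n))
  (Copy q, k, u, enc_nat n ++ v, o) (q, k, u ++ enc_nat n, v, o ++ enc_nat n).
Proof.
rewrite enc_natE /enc_bits; elim: (bin_aux n n) u o => [|b s IH] u o.
  by rewrite !cats1; apply: hreach_run.
have := IH (rcons (rcons u true) b) (rcons (rcons o true) b).
rewrite !cat_rcons; apply: (hreach_trans (m := 2)); exact: hreach_run.
Qed.

Lemma hreach_copy_rewind e n q k v o : hreach e (size (enc_nat n)).+1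
  (Copy (Rewind q), k, [::], enc_nat n ++ v, o) (q, k, [::], enc_nat n ++ v, o ++ enc_nat n).
Proof.
rewrite -addn1; apply: hreach_trans; first exact: hreach_copy.
exact: hreach_run.
Qed.

Lemma hreach_drop e n q k v o : hreach e (size (enc_nat n))
  (Drop q, k, [::], enc_nat n ++ v, o) (q, k, [::], v, o).
Proof.
rewrite enc_natE /enc_bits; elim: (bin_aux n n) => [|b s IH]; first exact: hreach_run.
by apply: (hreach_trans (m := 2)); first exact: hreach_run.
Qed.

Lemma enc_nat_neq0 n v : enc_nat n ++ v <> [::].
Proof. by rewrite enc_natE /enc_bits; case: (bin_aux n n). Qed.

Lemma enc_const_cat a v :
  enc_ph_term (PT_const a) ++ v = enc_nat 0 ++ enc_nat a ++ v.
Proof. by rewrite catA. Qed.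

Lemma enc_mul_cat a x v :
  enc_ph_term (PT_mul a x) ++ v = enc_nat 1 ++ enc_nat a ++ enc_nat x ++ v.
Proof. rewrite -[enc_ph_term _]/(enc_nat 1 ++ enc_nat a ++ enc_nat x); cat_reassoc. Qed.

Lemma enc_add_cat t1 t2 v : enc_ph_term (PT_add t1 t2) ++ v =
  enc_nat 2 ++ enc_ph_term t1 ++ enc_ph_term t2 ++ v.
Proof. rewrite -[enc_ph_term (PT_add _ _)]/(enc_nat 2 ++ enc_ph_term t1 ++ enc_ph_term t2); cat_reassoc. Qed.

Lemma enc_le_cat t1 t2 v : enc_ph (PH_le t1 t2) ++ v =
  enc_nat 0 ++ enc_ph_term t1 ++ enc_ph_term t2 ++ v.
Proof. rewrite -[enc_ph _]/(enc_nat 0 ++ enc_ph_term t1 ++ enc_ph_term t2); cat_reassoc. Qed.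

Lemma enc_not_cat g v : enc_ph (PH_not g) ++ v = enc_nat 1 ++ enc_ph g ++ v.
Proof. rewrite -[enc_ph (PH_not _)]/(enc_nat 1 ++ enc_ph g); cat_reassoc. Qed.

Lemma enc_and_cat g h v :
  enc_ph (PH_and g h) ++ v = enc_nat 2 ++ enc_ph g ++ enc_ph h ++ v.
Proof. rewrite -[enc_ph (PH_and _ _)]/(enc_nat 2 ++ enc_ph g ++ enc_ph h); cat_reassoc. Qed.

Lemma enc_ex_cat x g v :
  enc_ph (PH_ex x g) ++ v = enc_nat 3 ++ enc_nat x ++ enc_ph g ++ v.
Proof. rewrite -[enc_ph (PH_ex _ _)]/(enc_nat 3 ++ enc_nat x ++ enc_ph g); cat_reassoc. Qed.

Lemma enc_hartig_cat x y g v : enc_ph (PH_hartig x y g) ++ v =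
  enc_nat 4 ++ enc_nat x ++ enc_nat y ++ enc_ph g ++ v.
Proof. rewrite -[enc_ph (PH_hartig _ _ _)]/(enc_nat 4 ++ enc_nat x ++ enc_nat y ++ enc_ph g); cat_reassoc. Qed.

Lemma enc_ph_term_neq0 t v : enc_ph_term t ++ v <> [::].
Proof.
case: t => *; rewrite ?enc_const_cat ?enc_mul_cat ?enc_add_cat;
exact: enc_nat_neq0.
Qed.

Lemma enc_ph_neq0 f v : enc_ph f ++ v <> [::].
Proof.
case: f => *; rewrite ?enc_le_cat ?enc_not_cat ?enc_and_cat ?enc_ex_cat ?enc_hartig_cat;
exact: enc_nat_neq0.
Qed.

(** A crude rate per input bit: all fixed strings together, with 20 covering the control steps and
    the repeated passes over a number. *)
Definition node_cost (e : bool) : nat :=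
  size (s_const1 e) + size (s_const2 e) + size s_const3 +
  (size (s_mul1 e) + size (s_mul2 e) + size (s_mul3 e) + size (s_mul4 e) + size s_mul5) +
  (size (s_binary e rel_add) + size (s_binary e rel_le) + size (s_binary e rel_and)) +
  size (s_exists e) +
  (size (s_hartig1 e) + size (s_hartig2 e) + size (s_hartig3 e) + size (s_hartig4 e)) +
  size (s_rebind e vsnd) + size (enc_nat 2) + size (s_bind e) + size (s_top e) +
  size (enc_ks loop_ks) + 20.

Lemma hreach_binary e q k v o : v <> [::] -> hreach e (size (s_binary e q))
  (p_binary e q, k, [::], v, o) (Jump true, k, [::], v, o ++ s_binary e q).
Proof. exact: hreach_emits. Qed.

Lemma hreach_next e k v o : v <> [::] -> hreach e (size (s_rebind e vsnd)).+1
  (p_after e, k, [::], v, o) (Jump true, k, [::], v, o ++ s_rebind e vsnd).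
Proof.
move=> v0; rewrite -addn1 addnC; apply: hreach_trans; last exact: hreach_emits.
by apply: hreach_run; case: v v0.
Qed.

(** No stack is required: a node emits nothing after its last child, so it is left exactly as its
    last leaf is, in [p_after]. *)
Lemma hreach_term e t k v o : hreach e (node_cost e * size (enc_ph_term t))
  (Jump true, k.+1, [::], enc_ph_term t ++ v, o)
  (p_after e, k, [::], v, o ++ enc_cform (tr_term e t)).
Proof.
elim: t k v o => [a|a x|t1 IH1 t2 IH2] k v o.
- rewrite enc_const_cat; apply: hreach_le; last first.
    apply: (hreach_trans (m := 3)); first by rewrite enc_nat0; apply: hreach_run.
    apply: hreach_trans; first by apply: hreach_emits; apply: enc_nat_neq0.
    apply: hreach_trans; first exact: hreach_copy_rewind.
    apply: hreach_trans; first by apply: hreach_emits; apply: enc_nat_neq0.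
    apply: hreach_trans; first exact: hreach_copy_rewind.
    apply: hreach_trans; first by apply: hreach_emits; apply: enc_nat_neq0.
    apply: hreach_trans; first exact: hreach_drop.
    apply: (hreach_trans (m := 1)); first exact: hreach_run.
    by apply: hreach_output; rewrite enc_tr_const; cat_reassoc.
  have -> : size (enc_ph_term (PT_const a)) = (size (enc_nat a)).+1.
    by rewrite -[enc_ph_term _]cats0 enc_const_cat cats0 enc_nat0.
  by rewrite /node_cost; nia.
- rewrite enc_mul_cat; apply: hreach_le; last first.
    apply: (hreach_trans (m := 5)); first by rewrite enc_nat1; apply: hreach_run.
    apply: hreach_trans; first by apply: hreach_emits; apply: enc_nat_neq0.
    apply: hreach_trans; first exact: hreach_copy_rewind.
    apply: hreach_trans; first by apply: hreach_emits; apply: enc_nat_neq0.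
    apply: hreach_trans; first exact: hreach_copy_rewind.
    apply: hreach_trans; first exact: hreach_drop.
    apply: hreach_trans; first by apply: hreach_emits; apply: enc_nat_neq0.
    apply: hreach_trans; first exact: hreach_copy_rewind.
    apply: hreach_trans; first by apply: hreach_emits; apply: enc_nat_neq0.
    apply: hreach_trans; first exact: hreach_copy_rewind.
    apply: hreach_trans; first by apply: hreach_emits; apply: enc_nat_neq0.
    apply: hreach_trans; first exact: hreach_drop.
    apply: (hreach_trans (m := 1)); first exact: hreach_run.
    by apply: hreach_output; rewrite enc_tr_mul; cat_reassoc.
  have -> : size (enc_ph_term (PT_mul a x)) = 3 + (size (enc_nat a) + size (enc_nat x)).
    by rewrite -[enc_ph_term _]cats0 enc_mul_cat cats0 enc_nat1 !size_cat.
  by rewrite /node_cost; nia.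
- rewrite enc_add_cat; apply: hreach_le; last first.
    (* A jump, the counter test, five tag bits, and [Inc], since a sum replaces one awaited term by
       two. *)
    apply: (hreach_trans (m := 8)); first by rewrite enc_nat2; apply: hreach_run.
    apply: hreach_trans; first by apply: hreach_binary; apply: enc_ph_term_neq0.
    apply: hreach_trans; first exact: IH1.
    apply: hreach_trans; first by apply: hreach_next; apply: enc_ph_term_neq0.
    apply: hreach_trans; first exact: IH2.
    apply: hreach_output; 
    rewrite -[tr_term _ (PT_add _ _)]/(c_binary e rel_add (tr_term e t1) (tr_term e t2)).
    rewrite enc_c_binary.
    by cat_reassoc.
  have -> : size (enc_ph_term (PT_add t1 t2)) =
      5 + (size (enc_ph_term t1) + size (enc_ph_term t2)).
    by rewrite -[enc_ph_term (PT_add _ _)]cats0 enc_add_cat cats0 enc_nat2 !size_cat.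
  by rewrite /node_cost; nia.
Qed.

Lemma hreach_form e f v o : hreach e (node_cost e * size (enc_ph f))
  (Jump true, 0, [::], enc_ph f ++ v, o)
  (p_after e, 0, [::], v, o ++ enc_cform (tr_form e f)).
Proof.
elim: f v o => [t1 t2|g IH|g IHg h IHh|x g IH|x y g IH] v o.
- rewrite enc_le_cat; apply: hreach_le; last first.
    apply: (hreach_trans (m := 5)); first by rewrite enc_nat0; apply: hreach_run.
    apply: hreach_trans; first by apply: hreach_binary; apply: enc_ph_term_neq0.
    apply: hreach_trans; first exact: hreach_term.
    apply: hreach_trans; first by apply: hreach_next; apply: enc_ph_term_neq0.
    apply: hreach_trans; first exact: hreach_term.
    apply: hreach_output.
    rewrite -[tr_form _ (PH_le _ _)]/(c_binary e rel_le (tr_term e t1) (tr_term e t2)).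
    by rewrite enc_c_binary; cat_reassoc.
  have -> : size (enc_ph (PH_le t1 t2)) =
      1 + (size (enc_ph_term t1) + size (enc_ph_term t2)).
    by rewrite -[enc_ph _]cats0 enc_le_cat cats0 enc_nat0 !size_cat.
  by rewrite /node_cost; nia.
- rewrite enc_not_cat; apply: hreach_le; last first.
    apply: (hreach_trans (m := 5)); first by rewrite enc_nat1; apply: hreach_run.
    apply: hreach_trans; first by apply: hreach_emits; apply: enc_ph_neq0.
    apply: hreach_trans; first exact: IH.
    apply: hreach_output.
    rewrite -[tr_form _ (PH_not _)]/(C_not (tr_form e g)).
    by rewrite enc_C_not; cat_reassoc.
  have -> : size (enc_ph (PH_not g)) = 3 + size (enc_ph g).
    by rewrite -[enc_ph (PH_not _)]cats0 enc_not_cat cats0 enc_nat1 !size_cat.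
  by rewrite /node_cost; nia.
- rewrite enc_and_cat; apply: hreach_le; last first.
    apply: (hreach_trans (m := 7)); first by rewrite enc_nat2; apply: hreach_run.
    apply: hreach_trans; first by apply: hreach_binary; apply: enc_ph_neq0.
    apply: hreach_trans; first exact: IHg.
    apply: hreach_trans; first by apply: hreach_next; apply: enc_ph_neq0.
    apply: hreach_trans; first exact: IHh.
    apply: hreach_output.
    rewrite -[tr_form _ (PH_and _ _)]/(c_binary e rel_and (tr_form e g) (tr_form e h)).
    by rewrite enc_c_binary; cat_reassoc.
  have -> : size (enc_ph (PH_and g h)) = 5 + (size (enc_ph g) + size (enc_ph h)).
    by rewrite -[enc_ph (PH_and _ _)]cats0 enc_and_cat cats0 enc_nat2 !size_cat.
  by rewrite /node_cost; nia.
- rewrite enc_ex_cat; apply: hreach_le; last first.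
    apply: (hreach_trans (m := 7)); first by rewrite enc_nat3; apply: hreach_run.
    apply: hreach_trans; first by apply: hreach_emits; apply: enc_nat_neq0.
    apply: hreach_trans; first exact: hreach_copy_rewind.
    apply: hreach_trans; first exact: hreach_drop.
    apply: hreach_trans; first exact: IH.
    by apply: hreach_output; rewrite enc_tr_ex; cat_reassoc.
  have -> : size (enc_ph (PH_ex x g)) = 5 + (size (enc_nat x) + size (enc_ph g)).
    by rewrite -[enc_ph (PH_ex _ _)]cats0 enc_ex_cat cats0 enc_nat3 !size_cat.
  by rewrite /node_cost; nia.
- rewrite enc_hartig_cat; apply: hreach_le; last first.
    apply: (hreach_trans (m := 9)); first by rewrite enc_nat4; apply: hreach_run.
    apply: hreach_trans; first by apply: hreach_emits; apply: enc_nat_neq0.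
    apply: hreach_trans; first exact: hreach_copy_rewind.
    apply: hreach_trans; first by apply: hreach_emits; apply: enc_nat_neq0.
    apply: hreach_trans; first exact: hreach_copy_rewind.
    apply: hreach_trans; first exact: hreach_drop.
    apply: hreach_trans; first by apply: hreach_emits; apply: enc_nat_neq0.
    apply: hreach_trans; first exact: hreach_copy_rewind.
    apply: hreach_trans; first by apply: hreach_emits; apply: enc_nat_neq0.
    apply: hreach_trans; first exact: hreach_drop.
    apply: hreach_trans; first exact: IH.
    by apply: hreach_output; rewrite enc_tr_hartig; cat_reassoc.
  have -> : size (enc_ph (PH_hartig x y g)) =
      7 + (size (enc_nat x) + size (enc_nat y) + size (enc_ph g)).
    rewrite -[enc_ph (PH_hartig _ _ _)]cats0 enc_hartig_cat cats0 enc_nat4 !size_cat.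
    by rewrite /=; lia.
  by rewrite /node_cost; nia.
Qed.

Lemma hreach_bind e l k u o : hreach e
  (node_cost e * size (flatten (map enc_nat l)))
  (Jump false, k, u, flatten (map enc_nat l), o)
  (Jump false, k, u ++ flatten (map enc_nat l), [::],
   o ++ flatten [seq s_bind e ++ enc_nat n | n <- l]).
Proof.
elim: l u o => [|n l IH] u o.
  by apply: (hreach_le (leq0n _)); rewrite /= !cats0; exact: hreach_refl.
rewrite -[flatten (map enc_nat (n :: l))]/(enc_nat n ++ flatten (map enc_nat l)).
apply: hreach_le; last first.
  apply: (hreach_trans (m := 2) (d :=
    (emits (s_bind e) (Copy (Jump false)), k, u, enc_nat n ++ flatten (map enc_nat l), o))).
    by apply: hreach_run; rewrite enc_natE /enc_bits; case: (bin_aux n n).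
  apply: hreach_trans; first by apply: hreach_emits; apply: enc_nat_neq0.
  apply: hreach_trans; first exact: hreach_copy.
  apply: hreach_trans; first exact: IH.
  rewrite -[flatten [seq _ | _ <- n :: l]]/((s_bind e ++ enc_nat n) ++
    flatten [seq s_bind e ++ enc_nat m | m <- l]).
  rewrite (catA u) (catA o (_ ++ _)) (catA o (s_bind e)).
  exact: hreach_refl.
have : 0 < size (enc_nat n) by rewrite lt0n size_eq0; have := @enc_nat_neq0 n [::];
  rewrite cats0; move/eqP.
by rewrite size_cat /node_cost; nia.
Qed.

Lemma hreach_top e f : hreach e (node_cost e * (2 * size (enc_ph f) + 2))
  (p_start, 0, [::], enc_ph f, [::])
  (Fin, 0, [::], [::], enc_instance loop_ks (tr_top e f)).
Proof.
apply: hreach_le; last first.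
  apply: hreach_trans.
    by apply: hreach_emits; have := @enc_ph_neq0 f [::]; rewrite cats0.
  apply: hreach_trans; first by rewrite enc_ph_numbers; apply: hreach_bind.
  (* A jump, the detection of the end of the input, and the rewinding. *)
  apply: (hreach_trans (m := 3)); first exact: hreach_run.
  rewrite cats0 -enc_ph_numbers.
  apply: hreach_trans.
    by apply: hreach_emits; have := @enc_ph_neq0 f [::]; rewrite cats0.
  apply: hreach_trans; first by rewrite -[enc_ph f]cats0; apply: hreach_form.
  apply: (hreach_trans (m := 1)); first exact: hreach_run.
  apply: hreach_output; rewrite /enc_instance enc_tr_top cat0s; cat_reassoc.
by rewrite -enc_ph_numbers /node_cost; nia.
Qed.

(** The running time is only quadratic. With m = n + 2, both A <= 2^A and m <= 2^m, and the exponent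
    A + 2m is at most 2m(A + 1), hence at most m^(A + 2). *)
Lemma exp_bound_quadratic A : exists c, forall n, A * n.+2 ^ 2 <= exp_bound c n.
Proof.
exists A.+2 => n; rewrite /exp_bound; set m := n.+2.
have m2 : 1 < m by [].
have lt2 k : k < 2 ^ k by apply: ltn_expl.
apply: (@leq_trans (2 ^ (A + m * 2))).
  rewrite expnD expnM leq_mul ?(ltnW (lt2 A)) // leq_exp2r //.
  exact: ltnW (lt2 m).
rewrite leq_exp2l // expnS expnS.
have : A < m ^ A by apply: leq_trans (lt2 A) _; case: (A) => // A'; rewrite leq_exp2r.
move: (m ^ A) => X AX; apply: (@leq_trans (m * (2 * A.+1))); first by nia.
by rewrite !leq_mul.
Qed.

Lemma exptime_reduction e : exptime_reduction_to_MC_FKS (frag e).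
Proof.
set B := node_cost e.
have [c cP] := exp_bound_quadratic ((B * 2) * (2 * (1 + B * 2) + 9) + 1).
exists (machine (p_body e) p_start), c => f; exists loop_ks, (tr_top e f).
split; last first.
  split; first exact: flat_loop_ks.
  by split; [exact: frag_tr_top | exact: iff_sym (models_tr_top e f)].
have [m mle /machine_computes] := hreach_top e f.
move=> [k [kle kP]]; exists k; split=> //.
apply: leq_trans kle (leq_trans _ (cP _)); rewrite -/B in mle *.
set n := size _ in mle *.
have mle' : m <= B * 2 * n.+2 by nia.
(* The summands of the running time are made homogeneous of degree two in n + 2. *)
apply: (@leq_trans (B * 2 * n.+2 * (2 * (n.+2 + B * 2 * n.+2) + 9 * n.+2) + n.+2 ^ 2)).
  apply: leq_add; last by rewrite expn_gt0.
  by apply: leq_mul => //; lia.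
by rewrite expnS expn1; nia.
Qed.

Theorem theorem13 :
  exptime_reduction_to_MC_FKS is_cltl /\ exptime_reduction_to_MC_FKS is_cctl.
Proof. by split; [apply: (exptime_reduction false) | apply: (exptime_reduction true)]. Qed.
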